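(* Let $E$ be an order continuous Köthe function space over the complete, $\sigma$-finite measure space $(S,\mathcal{A},\mu)$ and let $X$ be an luacs Banach space. If (a) $E$ is WLUR, or (b) $E$ is $\mathrm{luacs}^+$ and the Köthe dual $E'$ is also order continuous, then the Köthe-Bochner space $E(X)$ is also luacs.
   Context: All Banach spaces are real. For a Banach space $X$, $X^*$ denotes its dual, $B_X$ its closed unit ball and $S_X$ its unit sphere. A Banach space $X$ is called: - WLUR (weakly locally uniformly rotund) if for every $x\in S_X$ and every sequence $(x_n)$ in $S_X$, $\|x_n+x\|\to2$ implies $x_n\to x$ weakly; - luacs (locally uniformly alternatively convex or smooth) if for every $x\in S_X$, every sequence $(x_n)$ in $S_X$ and every $x^*\in S_{X^*}$: $\|x_n+x\|\to 2$ and $x^*(x_n)\to1$ imply $x^*(x)=1$; - $\mathrm{luacs}^+$ if for every $x\in S_X$, every sequence $(x_n)$ in $S_X$ with $\|x_n+x\|\to2$ and all $x^*\in S_{X^*}$: $x^*(x_n)\to1$ if and only if $x^*(x)=1$. A Köthe function space over a complete, $\sigma$-finite measure space $(S,\mathcal{A},\mu)$ is a Banach space $(E,\|\cdot\|_E)$ of real-valued measurable functions on $S$ modulo equality $\mu$-a.e. such that: (i) $\chi_A\in E$ for every $A\in\mathcal{A}$ with $\mu(A)<\infty$; (ii) every $f\in E$ is $\mu$-integrable over every $A\in\mathcal{A}$ with $\mu(A)<\infty$; (iii) if $g$ is measurable and $f\in E$ with $|g(t)|\le|f(t)|$ $\mu$-a.e., then $g\in E$ and $\|g\|_E\le\|f\|_E$.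 With the order $f\le g$ iff $f(t)\le g(t)$ $\mu$-a.e., $E$ is a Banach lattice; $E$ is order continuous if every decreasing net in $E$ with infimum zero is norm-convergent to zero. The Köthe dual $E'$ is the space of all measurable $g:S\to\mathbb{R}$ (modulo equality a.e.) with $\|g\|_{E'}:=\sup\{\int_S|fg|\,\mathrm{d}\mu:f\in B_E\}<\infty$; it is again a Köthe function space. For a Köthe function space $E$ and a Banach space $X$, the Köthe-Bochner space $E(X)$ is the Banach space of all Bochner-measurable functions $f:S\to X$ (modulo equality a.e.) with $\|f(\cdot)\|\in E$, normed by $\|f\|_{E(X)}=\|\,\|f(\cdot)\|\,\|_E$; Bochner-measurable means being the $\mu$-a.e. norm limit of a sequence of simple functions. *)

(* Defs.v *)
From HB Require Import structures.
From mathcomp Require Import all_boot all_order all_algebra.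
From mathcomp Require Import ring_quotient.
From mathcomp Require Import all_classical all_reals all_analysis.
From mathcomp Require Import measurable_realfun.

Set Implicit Arguments.
Unset Strict Implicit.
Unset Printing Implicit Defensive.

Import Order.TTheory GRing.Theory Num.Theory.
Import numFieldNormedType.Exports.

Local Open Scope classical_set_scope.
Local Open Scope ring_scope.

Section Rotundity.
Context {R : realType} (X : normedModType R).

Definition unit_sphere : set X := [set x | `|x| = 1].

Definition dual_norm (f : X -> R) : R :=
  sup [set `|f x| | x in [set x : X | `|x| <= 1]].

(* The unit sphere of the dual; [R^o] is [R] as a normed space over itself. *)
Definition dual_sphere (f : {linear X -> R^o}) : Prop :=
  continuous f /\ dual_norm f = 1.

Definition weakly_converges (u : nat -> X) (x : X) : Prop :=
  forall f : {linear X -> R^o}, continuous f ->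
    (fun n => f (u n)) @ \oo --> (f x : R^o).

Definition WLUR : Prop :=
  forall (x : X) (u : nat -> X),
    unit_sphere x -> (forall n, unit_sphere (u n)) ->
    (fun n => `|u n + x|) @ \oo --> (2 : R) ->
    weakly_converges u x.

Definition luacs : Prop :=
  forall (x : X) (u : nat -> X) (f : {linear X -> R^o}),
    unit_sphere x -> (forall n, unit_sphere (u n)) -> dual_sphere f ->
    (fun n => `|u n + x|) @ \oo --> (2 : R) ->
    (fun n => f (u n)) @ \oo --> (1 : R^o) ->
    f x = 1.

Definition luacs_plus : Prop :=
  forall (x : X) (u : nat -> X),
    unit_sphere x -> (forall n, unit_sphere (u n)) ->
    (fun n => `|u n + x|) @ \oo --> (2 : R) ->
    forall f : {linear X -> R^o}, dual_sphere f ->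
      ((fun n => f (u n)) @ \oo --> (1 : R^o)) <-> f x = 1.

End Rotundity.

(* A seminorm given on a linear subspace [sdom] of [V]; the values of [snorm]
   outside [sdom] are irrelevant. *)
Record seminormed (R : realType) (V : lmodType R) := Seminormed {
  sdom : set V;
  snorm : V -> R;
  sdom0 : sdom 0;
  sdomP : forall (a : R) f g, sdom f -> sdom g -> sdom (a *: f + g);
  snormD : forall f g, sdom f -> sdom g -> snorm (f + g) <= snorm f + snorm g;
  snormZ : forall (a : R) f, sdom f -> snorm (a *: f) = `|a| * snorm f
}.

Section SeminormQuotient.
Context (R : realType) (V : lmodType R) (p : seminormed V).

Definition sdom_pred : {pred V} := fun f => f \in sdom p.

Lemma sdom_submod_closed : submod_closed sdom_pred.
Proof.
split; first by apply: mem_set; exact: sdom0.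
by move=> a f g /set_mem pf /set_mem pg; apply: mem_set; exact: sdomP.
Qed.

HB.instance Definition _ :=
  GRing.isSubmodClosed.Build R V sdom_pred sdom_submod_closed.

Record selt := SElt { selt_val :> V; selt_valP : selt_val \in sdom_pred }.

HB.instance Definition _ := [isSub for selt_val].
HB.instance Definition _ := [Choice of selt by <:].
HB.instance Definition _ := [SubChoice_isSubLmodule of selt by <:].

Lemma seltP (f : selt) : sdom p f.
Proof. exact: set_mem (selt_valP f). Qed.

Lemma snorm0 : snorm p 0 = 0.
Proof. by rewrite -(scale0r 0) snormZ ?normr0 ?mul0r//; exact: sdom0. Qed.

Lemma snormN f : sdom p f -> snorm p (- f) = snorm p f.
Proof. by move=> pf; rewrite -scaleN1r snormZ// normrN1 mul1r. Qed.

Lemma snorm_ge0 f : sdom p f -> 0 <= snorm p f.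
Proof.
move=> pf; have pN : sdom p (- f).
  by rewrite -scaleN1r -[X in sdom p X]addr0; apply: sdomP => //; exact: sdom0.
have := snormD pf pN; rewrite subrr snorm0 snormN// => h.
by rewrite -mulr2n pmulrn_lge0 in h.
Qed.

Definition snull : {pred selt} := fun f => snorm p (selt_val f) == 0.

Lemma snull_submod_closed : submod_closed snull.
Proof.
split; first by rewrite unfold_in /= snorm0.
move=> a f g; rewrite !unfold_in => /eqP f0 /eqP g0.
apply/eqP/le_anti; rewrite (snorm_ge0 (seltP _)) andbT /=.
have paf : sdom p (a *: selt_val f) by exact: (seltP (a *: f)).
by rewrite (le_trans (snormD paf (seltP g)))// snormZ ?f0 ?g0 ?mulr0 ?addr0//;
  exact: seltP.
Qed.

HB.instance Definition _ :=
  GRing.isSubmodClosed.Build R selt snull snull_submod_closed.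

(* [sdom] modulo the vectors of seminorm zero; for the function spaces below
   this is equality almost everywhere, see [kspace_eqP] and
   [bochner_space_eqP]. *)
Definition squot : Type := Quotient.quot (snull : zmodClosed selt).

HB.instance Definition _ := GRing.Zmodule.on squot.
HB.instance Definition _ := EqQuotient.on squot.

Local Open Scope quotient_scope.

Definition sclass (f : selt) : squot := \pi_squot f.
Definition srepr (x : squot) : selt := repr x.

Lemma sreprK x : sclass (srepr x) = x.
Proof. exact: reprK. Qed.

Lemma sclassP f g : sclass f = sclass g <-> f - g \in snull.
Proof. by rewrite (Quotient.idealrBE snull); split=> /eqP. Qed.

Lemma sclass_srepr f : srepr (sclass f) - f \in snull.
Proof. by apply/sclassP; rewrite sreprK. Qed.

Lemma sclassD f g : sclass (f + g) = sclass f + sclass g.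
Proof. exact: (Quotient.pi_add (snull : zmodClosed selt)). Qed.

Lemma sclass0 : sclass 0 = 0.
Proof. by rewrite /sclass [RHS]/(GRing.zero) /= /Quotient.zero; unlock. Qed.

Definition squot_scale (a : R) (x : squot) : squot := sclass (a *: srepr x).

Lemma sclassZ a f : sclass (a *: f) = squot_scale a (sclass f).
Proof.
by apply/esym/sclassP; rewrite -scalerBr rpredZ//; exact: sclass_srepr.
Qed.

Fact squot_scalerA a b x :
  squot_scale a (squot_scale b x) = squot_scale (a * b) x.
Proof. by rewrite -(sreprK x) -!sclassZ scalerA. Qed.

Fact squot_scale1r : left_id 1 squot_scale.
Proof. by move=> x; rewrite -(sreprK x) -sclassZ scale1r. Qed.

Fact squot_scalerDr : right_distributive squot_scale +%R.
Proof.
move=> a x y; rewrite -(sreprK x) -(sreprK y) -sclassD -!sclassZ.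
by rewrite scalerDr sclassD.
Qed.

Fact squot_scalerDl x : {morph squot_scale^~ x : a b / a + b}.
Proof. by move=> a b; rewrite -(sreprK x) -!sclassZ scalerDl sclassD. Qed.

HB.instance Definition _ := GRing.Zmodule_isLmodule.Build R squot
  squot_scalerA squot_scale1r squot_scalerDr squot_scalerDl.

Definition squot_norm (x : squot) : R := snorm p (srepr x).

Lemma sdomB (f g : selt) : sdom p (selt_val f - selt_val g).
Proof. exact: (seltP (f - g)). Qed.

Lemma sclass_norm f : squot_norm (sclass f) = snorm p f.
Proof.
have le_snorm (g h : selt) : g - h \in snull -> snorm p g <= snorm p h.
  rewrite unfold_in => /eqP gh0.
  rewrite -[X in snorm p X <= _](subrK (selt_val h)).
  rewrite (le_trans (snormD (sdomB _ _) (seltP h)))//.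
  by rewrite -[leRHS]add0r lerD2r -gh0.
apply: le_anti; rewrite /squot_norm !le_snorm//; last exact: sclass_srepr.
by rewrite -opprB rpredN; exact: sclass_srepr.
Qed.

Fact squot_normD x y : squot_norm (x + y) <= squot_norm x + squot_norm y.
Proof.
rewrite -(sreprK x) -(sreprK y) -sclassD !sclass_norm.
exact: snormD (seltP _) (seltP _).
Qed.

Fact squot_normZ a x : squot_norm (a *: x) = `|a| * squot_norm x.
Proof.
rewrite -(sreprK x) -[a *: _]sclassZ !sclass_norm.
exact: snormZ (seltP _).
Qed.

Fact squot_norm_eq0 x : squot_norm x = 0 -> x = 0.
Proof.
move=> x0; rewrite -(sreprK x) -sclass0; apply/sclassP.
by rewrite subr0 unfold_in; apply/eqP.
Qed.

HB.instance Definition _ := Lmodule_isNormed.Build R squot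
  squot_normD squot_normZ squot_norm_eq0.

Lemma squot_normE f : `|sclass f| = snorm p f.
Proof. exact: sclass_norm. Qed.

End SeminormQuotient.

Section KoetheSpaces.
Context d (S : measurableType d) (R : realType).
Variable mu : {measure set S -> \bar R}.

(* Functions are not identified when they agree almost everywhere: [kset] is
   the set of all representatives of elements of the space. By [kideal] it is
   closed under modification of a function on a null set, as long as the
   result is measurable, and such a modification does not change [knorm]. The
   Banach space itself is [kspace] below. *)
Record koethe := Koethe {
  kset : set (S -> R);
  knorm : (S -> R) -> R;
  kmeasurable : forall f, kset f -> measurable_fun setT f;
  kset0 : kset (fun=> 0);
  ksetP : forall (a : R) f g, kset f -> kset g ->
    kset (fun t => a * f t + g t);
  knormD : forall f g, kset f -> kset g ->
    knorm (fun t => f t + g t) <= knorm f + knorm g;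
  knormZ : forall (a : R) f, kset f ->
    knorm (fun t => a * f t) = `|a| * knorm f;
  knorm_eq0 : forall f, kset f -> knorm f = 0 ->
    \forall t \ae mu, f t = 0;
  kcomplete : forall u : nat -> S -> R, (forall n, kset (u n)) ->
    (forall e : R, 0 < e -> exists N : nat, forall m n : nat,
      (N <= m)%N -> (N <= n)%N -> knorm (fun t => u m t - u n t) < e) ->
    exists2 f, kset f &
      (fun n => knorm (fun t => u n t - f t)) @ \oo --> (0 : R);
  kindic : forall A : set S, measurable A -> (mu A < +oo)%E ->
    kset (\1_A : S -> R);
  kintegrable : forall f, kset f ->
    forall A : set S, measurable A -> (mu A < +oo)%E ->
      mu.-integrable A (EFin \o f);
  kideal : forall f g : S -> R, kset f -> measurable_fun setT g ->
    (\forall t \ae mu, `|g t| <= `|f t|) ->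
    kset g /\ knorm g <= knorm f
}.

(* Order continuity of the lattice of the functions in [D], ordered almost
   everywhere and normed by [N], stated for nets [u] indexed by a nonempty
   directed preorder. *)
Definition order_continuous (D : set (S -> R)) (N : (S -> R) -> R) : Prop :=
  forall (I : Type) (le : I -> I -> Prop) (u : I -> S -> R),
    inhabited I -> (forall i, le i i) ->
    (forall i j k, le i j -> le j k -> le i k) ->
    (forall i j, exists2 k, le i k & le j k) ->
    (forall i, D (u i)) ->
    (forall i j, le i j -> \forall t \ae mu, u j t <= u i t) ->
    (forall i, \forall t \ae mu, 0 <= u i t) ->
    (forall h, D h -> (forall i, \forall t \ae mu, h t <= u i t) ->
      \forall t \ae mu, h t <= 0) ->
    forall e : R, 0 < e -> exists i, forall j, le i j -> N (u j) < e.

Section OneSpace.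
Variable E : koethe.

Definition koethe_order_continuous : Prop :=
  order_continuous (kset E) (knorm E).

Definition kdual_enorm (g : S -> R) : \bar R :=
  ereal_sup [set (\int[mu]_t `|f t * g t|%:E)%E
            | f in [set f | kset E f /\ knorm E f <= 1]].

Definition kdual_set : set (S -> R) :=
  [set g | measurable_fun setT g /\ (kdual_enorm g < +oo)%E].

Definition kdual_norm (g : S -> R) : R := fine (kdual_enorm g).

Definition kdual_order_continuous : Prop :=
  order_continuous kdual_set kdual_norm.

Definition koethe_seminormed : seminormed (S -> R^o) :=
  @Seminormed R (S -> R^o) (kset E) (knorm E)
    (kset0 E) (@ksetP E) (@knormD E) (@knormZ E).

Definition kspace : Type := squot koethe_seminormed.
HB.instance Definition _ := NormedModule.on kspace.

Lemma knorm_ae f g : kset E f -> measurable_fun setT g ->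
  (\forall t \ae mu, f t = g t) -> kset E g /\ knorm E g = knorm E f.
Proof.
move=> Ef mg fg.
have [Eg gf] : kset E g /\ knorm E g <= knorm E f.
  by apply: kideal => //; apply: filterS fg => t ->.
split => //; apply/le_anti; rewrite gf /=.
have [] // := @kideal E g f Eg (kmeasurable Ef).
by apply: filterS fg => t ->.
Qed.

Lemma knorm_ae0 f : kset E f ->
  knorm E f = 0 <-> \forall t \ae mu, f t = 0.
Proof.
move=> Ef; split; first exact: knorm_eq0.
move=> /(knorm_ae Ef (@measurable_cst _ _ _ _ setT (0 : R)))[_ <-].
exact: (snorm0 koethe_seminormed).
Qed.

Lemma kspace_eqP (f g : selt koethe_seminormed) :
  sclass f = sclass g <-> \forall t \ae mu, selt_val f t = selt_val g t.
Proof.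
rewrite sclassP unfold_in.
have := knorm_ae0 (seltP (f - g)) => fg0.
split=> [/eqP/fg0|fg].
  by apply: filterS => t; exact: subr0_eq.
apply/eqP/fg0; apply: filterS fg => t fgt.
by change (selt_val f t - selt_val g t = 0); rewrite fgt subrr.
Qed.

End OneSpace.

Section Bochner.
Variable X : completeNormedModType R.

(* The level sets may have infinite measure; over a sigma-finite measure this
   yields the same Bochner-measurable functions. *)
Definition simple_function (s : S -> X) : Prop :=
  finite_set (range s) /\ forall x, measurable (s @^-1` [set x]).

Definition bochner_measurable (f : S -> X) : Prop :=
  exists s : nat -> S -> X, (forall n, simple_function (s n)) /\
    \forall t \ae mu, (fun n => s n t) @ \oo --> f t.

Lemma simple_function_preimage (s : S -> X) (B : set X) :
  simple_function s -> measurable (s @^-1` B).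
Proof.
move=> [fs ms].
rewrite (_ : s @^-1` B = \bigcup_(x in range s `&` B) s @^-1` [set x]).
  by apply: fin_bigcup_measurable => //; exact: finite_setIl.
apply/seteqP; split=> t /=; last by move=> [x [_ Bx]] ->.
by move=> Bst; exists (s t) => //; split => //; exists t.
Qed.

Lemma simple_function_lin (a : R) (s1 s2 : S -> X) :
  simple_function s1 -> simple_function s2 ->
  simple_function (a *: s1 + s2).
Proof.
move=> ss1 ss2; split.
  apply: (@sub_finite_set _ _
    ((fun z : X * X => a *: z.1 + z.2) @` (range s1 `*` range s2))).
    by move=> _ [t _ <-]; exists (s1 t, s2 t) => //; split; exists t.
  by apply: finite_image; apply: finite_setX; [case: ss1|case: ss2].
move=> x.
rewrite (_ : _ @^-1` _ = \bigcup_(y in range s1)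
    (s1 @^-1` [set y] `&` s2 @^-1` [set z | a *: y + z = x])).
  apply: fin_bigcup_measurable; first by case: ss1.
  by move=> y _; apply: measurableI; exact: simple_function_preimage.
apply/seteqP; split=> t /=; last by move=> [y _ [<- <-]].
by move=> tx; exists (s1 t) => //; exists t.
Qed.

Lemma bochner_measurable_lin (a : R) (f g : S -> X) :
  bochner_measurable f -> bochner_measurable g ->
  bochner_measurable (a *: f + g).
Proof.
move=> [s1 [ss1 s1f]] [s2 [ss2 s2g]].
exists (fun n => a *: s1 n + s2 n); split.
  by move=> n; exact: simple_function_lin.
apply: filterS2 s1f s2g => t s1f s2g.
exact: cvgD (cvgZr s1f) s2g.
Qed.

Lemma bochner_measurable0 : bochner_measurable 0.
Proof.
exists (fun=> 0); split; last by apply: aeW => t; exact: cvg_cst.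
move=> _; split.
  by apply: (sub_finite_set _ (finite_set1 (0 : X))) => _ [t _ <-].
move=> x; rewrite (_ : 0 = cst (0 : X) :> (S -> X))// preimage_cst.
by case: ifP.
Qed.

Hypothesis mu_complete : measure_is_complete mu.

Lemma bochner_measurable_norm (f : S -> X) :
  bochner_measurable f -> measurable_fun setT (fun t => `|f t|).
Proof.
move=> [s [ss [N [mN N0 subN]]]].
pose c t : R := `|f t| * (\1_(~` N) t : R).
apply/measurable_EFinP.
apply: (@ae_measurable_fun _ _ _ mu mu_complete setT (EFin \o c)).
  exists N; split => // t /= ct; apply: contrapT => Nt; apply: ct => _.
  by rewrite /c indicE mem_set// mulr1.
apply/measurable_EFinP.
apply: (@measurable_fun_cvg _ _ _ setT
    (fun n t => `|s n t| * (\1_(~` N) t : R))).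
  move=> n; apply: measurable_funM; last first.
    by apply: measurable_indic; exact: measurableC.
  move=> _ B mB; rewrite setTI.
  exact: (simple_function_preimage (fun x => B `|x|)).
move=> t _; rewrite /c indicE; have [Nt|Nt] := boolP (t \in ~` N).
  rewrite mulr1; under eq_fun do rewrite mulr1.
  apply: cvg_norm; apply: contrapT => nst.
  by move/set_mem: Nt; apply; exact: subN.
by rewrite mulr0; under eq_fun do rewrite mulr0; exact: cvg_cst.
Qed.

Variable E : koethe.

Definition bochner_set : set (S -> X) :=
  [set f | bochner_measurable f /\ kset E (fun t => `|f t|)].

Definition bochner_norm (f : S -> X) : R := knorm E (fun t => `|f t|).

Fact bochner_set0 : bochner_set 0.
Proof.
split; first exact: bochner_measurable0.
rewrite (_ : (fun _ => _) = (fun=> 0)); first exact: kset0.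
by apply/funext => t; exact: normr0.
Qed.

Fact bochner_lin (a : R) f g : bochner_set f -> bochner_set g ->
  bochner_set (a *: f + g) /\
  bochner_norm (a *: f + g) <= `|a| * bochner_norm f + bochner_norm g.
Proof.
move=> [bf Ef] [bg Eg].
have bfg := bochner_measurable_lin a bf bg.
pose h t := `|a| * `|f t| + `|g t|.
have Eh : kset E h by exact: ksetP.
have [Efg lefg] : kset E (fun t => `|(a *: f + g) t|) /\
    knorm E (fun t => `|(a *: f + g) t|) <= knorm E h.
  apply: kideal => //; first exact: bochner_measurable_norm.
  apply: aeW => t; rewrite normr_id ger0_norm; last first.
    by rewrite addr_ge0// mulr_ge0.
  by rewrite (le_trans (ler_normD _ _))// lerD2r normrZ.
split => //; apply: (le_trans lefg).
have Eaf : kset E (fun t => `|a| * `|f t|).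
  rewrite (_ : (fun _ => _) = (fun t => `|a| * `|f t| + 0)).
    exact: (ksetP _ Ef (kset0 E)).
  by apply/funext => t; rewrite addr0.
rewrite (le_trans (knormD Eaf Eg))// lerD2r.
by rewrite (knormZ _ Ef) normr_id.
Qed.

Fact bochner_setP (a : R) f g : bochner_set f -> bochner_set g ->
  bochner_set (a *: f + g).
Proof. by move=> bf bg; case: (bochner_lin a bf bg). Qed.

Fact bochner_normD f g : bochner_set f -> bochner_set g ->
  bochner_norm (f + g) <= bochner_norm f + bochner_norm g.
Proof.
move=> bf bg; have [_] := bochner_lin 1 bf bg.
by rewrite scale1r normr1 mul1r.
Qed.

Fact bochner_normZ (a : R) f : bochner_set f ->
  bochner_norm (a *: f) = `|a| * bochner_norm f.
Proof.
move=> [_ Ef]; rewrite /bochner_norm.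
rewrite (_ : (fun t => `|(a *: f) t|) = (fun t => `|a| * `|f t|)).
  by rewrite knormZ// normr_id.
by apply/funext => t; exact: normrZ.
Qed.

Definition bochner_seminormed : seminormed (S -> X) :=
  @Seminormed R (S -> X) bochner_set bochner_norm
    bochner_set0 bochner_setP bochner_normD bochner_normZ.

Definition bochner_space : Type := squot bochner_seminormed.
HB.instance Definition _ := NormedModule.on bochner_space.

Lemma bochner_space_eqP (f g : selt bochner_seminormed) :
  sclass f = sclass g <-> \forall t \ae mu, selt_val f t = selt_val g t.
Proof.
rewrite sclassP unfold_in.
have [_ Efg] := seltP (f - g).
have := knorm_ae0 Efg => fg0.
split=> [/eqP/fg0|fg].
  by apply: filterS => t /normr0_eq0; exact: subr0_eq.
apply/eqP/fg0; apply: filterS fg => t fgt.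
by change (`|selt_val f t - selt_val g t| = 0); rewrite fgt subrr normr0.
Qed.

End Bochner.
End KoetheSpaces.

(* Main.v *)
Require Import Defs.
From HB Require Import structures.
From mathcomp Require Import all_boot all_order all_algebra.
From mathcomp Require Import all_classical all_reals all_analysis.
From mathcomp Require Import measurable_realfun ring lra.

Set Implicit Arguments.
Unset Strict Implicit.
Unset Printing Implicit Defensive.

Import Order.TTheory GRing.Theory Num.Theory.
Import numFieldNormedType.Exports.

Local Open Scope classical_set_scope.
Local Open Scope ring_scope.

(** Fix f and u_n on the unit sphere of E(X) with |u_n + f| tending to 2 in
    norm, and a functional F of norm one with F(u_n) -> 1. Each alternative
    gives luacs+ for E ([WLUR_luacs_plus]). The plan is to push everything
    down to E, use luacs+ there, and then come back up to X at almost every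
    point.

    Going down. A sandwich form of the Hahn-Banach theorem gives a positive
    functional L of norm at most one on E with F(h) <= L(|h(.)|) for all h
    ([positive_majorant]). By order continuity L is integration against a
    finite measure m, after division by a strictly positive w in E
    ([weak_unit], [integral_representation]), and the set functions
    A |-> F(1_A u_n) have densities g_n with respect to m
    ([density_exists]), with g_n <= |u_n| / w almost everywhere. This takes
    the place of the representation of E(X)* by weak*-measurable functions:
    only countably many elements of E(X) are involved, so at almost every t
    all rational combinations of the numbers g_n(t) are dominated by
    1 / w(t) times the norms of the same combinations of the vectors u_n(t),
    and Hahn-Banach in X gives a functional at the point t
    ([density_combinations], [interpolation]).

    Using luacs+. Put x = |f(.)|, x_n = |u_n(.)| and
    y_n = max(0, |(u_n + f)(.)| - x), so that 0 <= y_n <= x_n. Since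
    F(u_n) <= L(x_n), L(x_n) -> 1 and hence L(x) = 1. As |(u_n + f)(.)| is
    at most y_n + x, the norms of y_n + x tend to 2 as well, and L(x) = 1
    gives L(y_n) -> 1. So the nonnegative functions (x_n - y_n) / w and
    x_n / w - g_n tend to 0 in L1(m), and almost everywhere along a
    subsequence.

    Coming back. Where x_n(t) does not tend to 0 along that subsequence, a
    further subsequence depending on t keeps |u_n(t)| bounded below, the
    normalized vectors satisfy the hypothesis of luacs in X, and the
    functional at t attains its norm at f(t): g(t) = x(t) / w(t), where g is
    the density for f ([luacs_functional], [pointwise_attainment]). Where
    x_n(t) -> 0, x(t) = 0 for almost all t: otherwise the x_n would be small
    on a set A of positive measure, the functional L(1_{~A} .) would still
    tend to 1 along x_n, and luacs+ would give L(1_{~A} x) = 1 = L(x), so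
    x = 0 almost everywhere on A ([vanishing_null]). Integrating,
    F(f) = L(x) = 1. *)

(** * Sublinear functionals and the sandwich theorem *)

Section HahnBanach.
Context {R : realType} (V : lmodType R).

Definition sublinear (p : V -> R) : Prop :=
  (forall x y, p (x + y) <= p x + p y) /\
  (forall a x, 0 <= a -> p (a *: x) = a * p x).

Definition cone (G : V -> R -> Prop) : Prop :=
  [/\ G 0 0,
      forall v r v' r', G v r -> G v' r' -> G (v + v') (r + r') &
      forall a v r, 0 <= a -> G v r -> G (a *: v) (a * r)].

Lemma sublinear0 p : sublinear p -> p 0 = 0.
Proof. by move=> [_ pZ]; rewrite -(scale0r 0) pZ// mul0r. Qed.

Lemma sublinear_geN p x : sublinear p -> - p (- x) <= p x.
Proof.
move=> sp; have [pD _] := sp.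
by rewrite lerNl -subr_ge0 opprK -(sublinear0 sp) -(subrr x) addrC pD.
Qed.

(** The linear functionals below it are those below [p] with [r <= f v]
    whenever [G v r]. *)
Definition sublinear_lower (p : V -> R) (G : V -> R -> Prop) (x : V) : R :=
  inf [set s | exists v r, G v r /\ s = p (x + v) - r].

(** The infimum is finite because [G v r] gives
    [p (x + v) - r >= p v - p (- x) - r >= - p (- x)]; it is sublinear because
    [G] is a cone. *)
Lemma sublinear_lowerP p G : sublinear p -> cone G ->
    (forall v r, G v r -> r <= p v) ->
  [/\ sublinear (sublinear_lower p G),
      forall x, sublinear_lower p G x <= p x &
      forall v r, G v r -> sublinear_lower p G (- v) <= - r].
Proof.
move=> sp [G0 GD GZ] Gp; have [pD pZ] := sp; set q := sublinear_lower p G.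
have lbq x : has_lbound [set s | exists v r, G v r /\ s = p (x + v) - r].
  exists (- p (- x)) => _ [v [r [Gvr ->]]].
  rewrite lerBrDr (le_trans _ (_ : p v - p (- x) <= _))//.
    by rewrite addrC lerD2r Gp.
  by rewrite lerBlDr (le_trans _ (pD _ _))// addrAC subrr add0r.
have qle x v r : G v r -> q x <= p (x + v) - r.
  by move=> Gvr; apply: ge_inf => //; exists v, r.
have le_q x c : (forall v r, G v r -> c <= p (x + v) - r) -> c <= q x.
  move=> h; apply: lb_le_inf; first by exists (p (x + 0) - 0), 0, 0.
  by move=> _ [v [r [Gvr ->]]]; exact: h.
have qZ a x : 0 < a -> a * q x <= q (a *: x).
  move=> a0; apply/le_q => v r Gvr.
  have /(qle x) : G (a^-1 *: v) (a^-1 * r) by apply: GZ => //; rewrite invr_ge0 ltW.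
  rewrite -(ler_pM2l a0) => /le_trans; apply.
  rewrite mulrBr mulrA divff ?gt_eqF// mul1r -pZ; last exact: ltW.
  by rewrite scalerDr scalerA divff ?gt_eqF// scale1r.
split.
- split=> [x y|a x].
    rewrite -lerBlDr; apply/le_q => v r Gvr.
    rewrite lerBlDl -lerBlDr; apply/le_q => v' r' Gvr'.
    rewrite lerBlDr (le_trans (qle _ _ _ (GD _ _ _ _ Gvr Gvr')))//.
    by have := pD (x + v) (y + v'); rewrite addrACA; lra.
  rewrite le_eqVlt => /predU1P[<-|a0].
    rewrite scale0r mul0r; apply/le_anti/andP; split.
      by have := qle 0 0 0 G0; rewrite addr0 subr0 (sublinear0 sp).
    by apply/le_q => v r Gvr; rewrite add0r subr_ge0 Gp.
  apply/le_anti/andP; split; last exact: qZ.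
  have := qZ a^-1 (a *: x); rewrite invr_gt0 => /(_ a0).
  by rewrite scalerA mulVf ?gt_eqF// scale1r ler_pdivrMl.
- by move=> x; have := qle x 0 0 G0; rewrite addr0 subr0.
- by move=> v r Gvr; have := qle (- v) v r Gvr; rewrite addNr (sublinear0 sp) sub0r.
Qed.

(** Zorn's lemma applies since the pointwise infimum of a chain of sublinear
    functionals below [p] is sublinear: for two members of the chain, the
    smaller one controls the value at [x + y]. It is bounded below by
    [- p (- x)]. *)
Lemma minimal_sublinear p : sublinear p ->
  exists q, [/\ sublinear q, forall x, q x <= p x &
    forall q', sublinear q' -> (forall x, q' x <= q x) -> q' = q].
Proof.
move=> sp.
pose T := {q : V -> R | sublinear q /\ forall x, q x <= p x}.
pose rel (a b : T) := `[< forall x, sval b x <= sval a x >].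
have [] := @Zorn T rel.
- by move=> t; apply/asboolP.
- move=> r s t /asboolP rs /asboolP st; apply/asboolP => x.
  exact: le_trans (st x) (rs x).
- move=> [s Hs] [t Ht] /asboolP /= st /asboolP /= ts; apply: eq_exist.
  by apply/funext => x; apply: le_anti; rewrite st ts.
- move=> A totA; have [[a Aa]|A0] := pselect (exists a, A a); last first.
    exists (exist _ p (conj sp (fun x => lexx _))) => s As.
    by exfalso; apply: A0; exists s.
  pose q x := inf [set sval s x | s in A].
  have lbq x : has_lbound [set sval s x | s in A].
    exists (- p (- x)) => _ [[s [ss sp']] As <-] /=.
    by rewrite (le_trans _ (sublinear_geN x ss))// lerN2.
  have qle s x : A s -> q x <= sval s x.
    by move=> As; apply: ge_inf => //; exists s.
  have le_q c x : (forall s, A s -> c <= sval s x) -> c <= q x.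
    move=> h; apply: lb_le_inf; first by exists (sval a x), a.
    by move=> _ [s As <-]; exact: h.
  have qD x y : q (x + y) <= q x + q y.
    rewrite -lerBlDr; apply/le_q => s As.
    rewrite lerBlDl -lerBlDr; apply/le_q => t At.
    rewrite lerBlDr.
    have [] := totA s t As At => /asboolP st.
      apply: le_trans (qle _ _ At) _; have [tD _] := (svalP t).1.
      by apply: le_trans (tD _ _) _; rewrite addrC lerD2l.
    apply: le_trans (qle _ _ As) _; have [sD _] := (svalP s).1.
    by apply: le_trans (sD _ _) _; rewrite addrC lerD2r.
  have qZ b x : 0 < b -> b * q x <= q (b *: x).
    move=> b0; apply/le_q => s As; have [_ sZ] := (svalP s).1.
    by rewrite (sZ _ _ (ltW b0)) ler_pM2l// qle.
  have sq : sublinear q.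
    split=> [//|b x]; rewrite le_eqVlt => /predU1P[<-|b0].
      rewrite scale0r mul0r; apply/le_anti/andP; split.
        by rewrite (le_trans (qle a 0 Aa))// (sublinear0 (svalP a).1).
      by apply/le_q => s As; rewrite (sublinear0 (svalP s).1).
    apply/le_anti/andP; split; last exact: qZ.
    have := qZ b^-1 (b *: x); rewrite invr_gt0 => /(_ b0).
    by rewrite scalerA mulVf ?gt_eqF// scale1r ler_pdivrMl.
  have qp x : q x <= p x by rewrite (le_trans (qle a x Aa))// (svalP a).2.
  by exists (exist _ q (conj sq qp)) => s As; apply/asboolP => x; exact: qle.
move=> [q [sq qp]] qmin; exists q; split=> [//|//|q' sq' q'q].
have q'p x : q' x <= p x by exact: le_trans (q'q x) (qp x).
have rq' : rel (exist _ q (conj sq qp)) (exist _ q' (conj sq' q'p)).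
  exact/asboolP.
by have /(congr1 sval) := qmin _ rq'.
Qed.

(** Hahn-Banach in the form of Mazur and Orlicz. A minimal sublinear [q] is
    linear: lowering [q] along the ray through [(y, q y)] gives a sublinear
    functional below [q], hence [q] itself, and this forces [q (- y) = - q y]. *)
Theorem sandwich p (G : V -> R -> Prop) : sublinear p -> cone G ->
    (forall v r, G v r -> r <= p v) ->
  exists f : {linear V -> R^o}, (forall x, f x <= p x) /\
    (forall v r, G v r -> r <= f v).
Proof.
move=> sp cG Gp; have [sP Pp PG] := sublinear_lowerP sp cG Gp.
have [q [sq qP qmin]] := minimal_sublinear sP; have [qD qZ] := sq.
have qN y : q (- y) = - q y.
  apply/le_anti/andP; split; last first.
    by rewrite -[y in leLHS]opprK sublinear_geN.
  (* The cone is the ray generated by (y, q y). *)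
  have [] := @sublinear_lowerP q
    (fun v r => exists2 t, 0 <= t & v = t *: y /\ r = t * q y) sq.
  - split.
    + by exists 0 => //; rewrite scale0r mul0r.
    + move=> _ _ _ _ [t t0 [-> ->]] [s s0 [-> ->]]; exists (t + s).
        exact: addr_ge0.
      by rewrite scalerDl mulrDl.
    + move=> a _ _ a0 [t t0 [-> ->]]; exists (a * t); first by rewrite mulr_ge0.
      by rewrite scalerA mulrA.
  - by move=> _ _ [t t0 [-> ->]]; rewrite qZ.
  move=> s1 s2 s3; rewrite -[in leLHS](qmin _ s1 s2); apply: s3.
  by exists 1 => //; rewrite scale1r mul1r.
have qlin : linear (q : V -> R^o).
  have q_D x y : q (x + y) = q x + q y.
    apply/le_anti/andP; split; first exact: qD.
    have := qD (x + y) (- y); rewrite addrK qN => h.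
    by rewrite -lerBrDr.
  have q_Z a x : q (a *: x) = a * q x.
    have [a0|a0] := leP 0 a; first exact: qZ.
    have Na0 : 0 <= - a by rewrite oppr_ge0 ltW.
    by apply: oppr_inj; rewrite -qN -scaleNr -mulNr qZ.
  by move=> a x y; rewrite q_D q_Z.
pose f : {linear V -> R^o} := HB.pack (q : V -> R^o)
  (GRing.isLinear.Build R V R^o *:%R q qlin).
exists f; split=> [x|v r Gvr] /=.
  exact: le_trans (qP x) (Pp x).
have := le_trans (qP (- v)) (PG _ _ Gvr).
by rewrite qN lerN2.
Qed.

End HahnBanach.

(** * Functionals of norm one on normed and seminormed spaces *)

Section Sequences.
Context {R : realType}.
Implicit Types u v : nat -> R.

Lemma cvg_dominated u v l :
  (forall n, `|u n - l| <= v n) -> v @ \oo --> (0 : R) -> u @ \oo --> l.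
Proof.
move=> uv v0; apply: (@squeeze_cvgr _ _ _ _ (fun n => l - v n) (fun n => l + v n)).
- by near=> n; have := uv n; rewrite ler_norml lerBlDl => /andP[h1 h2]; lra.
- by rewrite -[X in _ --> X]subr0; apply: cvgB v0; exact: cvg_cst.
- by rewrite -[X in _ --> X]addr0; apply: cvgD v0; exact: cvg_cst.
Unshelve. all: by end_near. Qed.

Lemma cvg_gap u l : u @ \oo --> l -> (fun n => l - u n) @ \oo --> (0 : R).
Proof.
by move=> ul; rewrite -[X in _ --> X](subrr l); apply: cvgB ul; exact: cvg_cst.
Qed.

Lemma cvg_uniqueR u (l l' : R) : u @ \oo --> l -> u @ \oo --> l' -> l = l'.
Proof. exact: cvg_unique. Qed.

Lemma cvg_geR u (l c : R) : u @ \oo --> l -> (forall n, c <= u n) -> c <= l.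
Proof.
move=> ul uc; rewrite -(cvg_lim (@Rhausdorff R) ul).
apply: limr_ge; first by apply/cvg_ex; exists l.
by near=> n; exact: uc.
Unshelve. all: end_near. Qed.

Lemma cvg_leR u (l c : R) : u @ \oo --> l -> (forall n, u n <= c) -> l <= c.
Proof.
move=> ul uc; rewrite -(cvg_lim (@Rhausdorff R) ul).
apply: limr_le; first by apply/cvg_ex; exists l.
by near=> n; exact: uc.
Unshelve. all: end_near. Qed.

Lemma cvg_subsequence u (l : R) (s : nat -> nat) :
  (forall n, (n <= s n)%N) -> u @ \oo --> l -> (fun n => u (s n)) @ \oo --> l.
Proof.
move=> sn /cvgrPdist_lt ul; apply/cvgrPdist_lt => e e0.
have [N _ hN] := ul e e0; exists N => // n /= Nn.
exact: hN (leq_trans Nn (sn n)).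
Qed.

Lemma not_cvg0_subsequence u : (forall n, 0 <= u n) ->
    ~ (u @ \oo --> (0 : R)) ->
  exists dl (s : nat -> nat), 0 < dl /\ forall n, (n <= s n)%N /\ dl <= u (s n).
Proof.
move=> u0 nu; apply: contrapT => H; apply: nu; apply/cvgr0Pnorm_lt => e e0.
have : ~ (forall N, exists n, (N <= n)%N /\ e <= u n).
  by move=> /choice[s hs]; apply: H; exists e, s.
move=> /existsNP[N hN]; exists N => // n /= Nn.
rewrite ger0_norm// ltNge; apply/negP => eu; apply: hN.
by exists n.
Qed.

End Sequences.

Section DualSphere.
Context {R : realType} (X : normedModType R).
Implicit Types (f : {linear X -> R^o}) (u : nat -> X) (x : X).

Lemma contraction_continuous f : (forall x, `|f x| <= `|x|) -> continuous f.
Proof.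
move=> f1; apply: bounded_linear_continuous; apply/linear_boundedP.
near=> r => x; rewrite (le_trans (f1 x))// ler_peMl//.
Unshelve. all: by end_near. Qed.

Lemma dual_sphere_contraction f x : dual_sphere f -> `|f x| <= `|x|.
Proof.
move=> [cf f1].
have /linear_boundedP/pinfty_ex_gt0[M M0 fM] :=
  continuous_linear_bounded 0 (cf 0).
have [->|x0] := eqVneq x 0; first by rewrite linear0 !normr0.
have nx : 0 < `|x| by rewrite normr_gt0.
have : `|f (`|x|^-1 *: x)| <= 1.
  rewrite -f1; apply: ub_le_sup.
    exists M => _ [y /= y1 <-]; apply: le_trans (fM y) _.
    by rewrite ler_piMr// ltW.
  exists (`|x|^-1 *: x) => //=.
  by rewrite normrZ ger0_norm ?invr_ge0// mulVf// gt_eqF.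
rewrite linearZ /= normrM ger0_norm ?invr_ge0//.
by rewrite mulrC ler_pdivrMr// mul1r.
Qed.

Lemma dual_sphereI f u : (forall x, `|f x| <= `|x|) ->
  (forall n, `|u n| <= 1) -> (fun n => f (u n)) @ \oo --> (1 : R^o) ->
  dual_sphere f.
Proof.
move=> f1 u1 fu; split; first exact: contraction_continuous.
have ub1 : ubound [set `|f x| | x in [set x : X | `|x| <= 1]] 1.
  by move=> _ [y /= y1 <-]; exact: le_trans (f1 y) y1.
apply/le_anti/andP; split.
  by apply: ge_sup => //; exists `|f 0|; exists 0 => //=; rewrite normr0.
apply: cvg_leR fu _ => n; apply: le_trans (ler_norm _) _.
by apply: ub_le_sup; [exists 1|exists (u n) => //=; exact: u1].
Qed.

(** Weak convergence of [u] to [x] gives [f (u n) --> f x], so this limit is 1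
    exactly when [f x = 1]. *)
Lemma WLUR_luacs_plus : WLUR X -> luacs_plus X.
Proof.
move=> wX x u x1 u1 ux f [cf _].
have fu := wX x u x1 u1 ux f cf.
by split=> [fu1|<-//]; exact: (@cvg_uniqueR _ (fun n => f (u n)) _ _ fu fu1).
Qed.

(** Normalizing [u n] moves it by [1 - `|u n| <= 2 - `|u n + x|], which tends to
    0. Either side of the equivalence puts [f] on the dual sphere, so it is
    enough that [f] is a contraction. *)
Lemma luacs_plus_ball x u f : luacs_plus X ->
    `|x| = 1 -> (forall n, `|u n| <= 1) ->
    (fun n => `|u n + x|) @ \oo --> (2 : R) ->
    (forall y, `|f y| <= `|y|) ->
  (fun n => f (u n)) @ \oo --> (1 : R^o) <-> f x = 1.
Proof.
move=> lX x1 u1 ux f1.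
pose s n := if u n == 0 then x else `|u n|^-1 *: u n.
have s1 n : unit_sphere (s n).
  rewrite /s /unit_sphere /=; case: eqVneq => [//|un0].
  by rewrite normrZ ger0_norm ?invr_ge0// mulVf// normr_eq0.
have gap0 := cvg_gap ux.
have su n : `|s n - u n| <= 2 - `|u n + x|.
  have -> : `|s n - u n| = 1 - `|u n|.
    rewrite /s; case: eqVneq => [->|un0]; first by rewrite normr0 !subr0.
    rewrite -[X in `|_ - X|]scale1r -scalerBl normrZ.
    have n0 : 0 < `|u n| by rewrite normr_gt0.
    rewrite ger0_norm; last by rewrite subr_ge0 invf_ge1.
    by rewrite mulrBl mul1r mulVf// gt_eqF.
  by have := ler_normD (u n) x; rewrite x1; lra.
have sx : (fun n => `|s n + x|) @ \oo --> (2 : R).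
  have dbl : (fun n => (2 - `|u n + x|) + (2 - `|u n + x|)) @ \oo --> (0 : R).
    by rewrite -[X in _ --> X]addr0; exact: cvgD.
  apply: (fun H => cvg_dominated H dbl) => n.
  have h1 : `|u n + x| <= `|s n + x| + `|s n - u n|.
    rewrite -[in leLHS](subrK (s n) (u n)) -addrA addrC.
    by rewrite (le_trans (ler_normD _ _))// lerD2l distrC.
  have h2 : `|s n + x| <= 2.
    by rewrite (le_trans (ler_normD _ _))// (s1 n) x1.
  have := su n; rewrite ler0_norm; lra.
have fsu : (fun n => f (s n) - f (u n)) @ \oo --> (0 : R).
  apply: (fun H => cvg_dominated H gap0) => n; rewrite subr0 -linearB.
  exact: le_trans (f1 _) (su n).
split=> [fu|fx].
  have fs : (fun n => f (s n)) @ \oo --> (1 : R^o).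
    rewrite (_ : (fun n => f (s n)) = fun n => (f (s n) - f (u n)) + f (u n)).
      by rewrite -[X in _ --> X]add0r; exact: (cvgD fsu fu).
    by apply/funext => n; rewrite subrK.
  have fS : dual_sphere f.
    by apply: dual_sphereI fs => // n; rewrite (s1 n).
  exact: (lX x s x1 s1 sx f fS).1 fs.
have fS : dual_sphere f.
  apply: (@dual_sphereI _ (fun=> x)) => //; first by rewrite x1.
  by rewrite fx; exact: cvg_cst.
have fs := (lX x s x1 s1 sx f fS).2 fx.
rewrite (_ : (fun n => f (u n)) = fun n => f (s n) - (f (s n) - f (u n))).
  by rewrite -[X in _ --> X]subr0; exact: (cvgB fs fsu).
by apply/funext => n; rewrite opprB addrC subrK.
Qed.

End DualSphere.

Section RawFunctionals.
Context {R : realType} (V : lmodType R) (p : seminormed V).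

(** Functionals on the quotient are handled through representatives; the
    norm bound makes the value independent of the representative. *)
Definition contractive (L : V -> R) : Prop :=
  (forall a f g, sdom p f -> sdom p g -> L (a *: f + g) = a * L f + L g) /\
  (forall f, sdom p f -> `|L f| <= snorm p f).

Lemma selt_extension (F : selt p -> R) :
  exists L : V -> R, forall f : selt p, L (selt_val f) = F f.
Proof.
exists (fun v => if pselect (sdom p v) is left pv
                 then F (SElt (mem_set pv)) else 0) => f.
case: pselect => [pf|]; last by case; exact: seltP.
by congr (F _); exact: val_inj.
Qed.

Lemma contractive_raw (F : {linear squot p -> R^o}) :
    (forall x, `|F x| <= `|x|) ->
  exists2 L, contractive L & forall f : selt p, L (selt_val f) = F (sclass f).
Proof.
move=> F1; have [L LE] := selt_extension (fun f => F (sclass f)).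
exists L => //; split.
  move=> a f g pf pg.
  pose f' := SElt (mem_set pf : f \in sdom_pred p).
  pose g' := SElt (mem_set pg : g \in sdom_pred p).
  rewrite (LE (a *: f' + g')) (LE f') (LE g').
  rewrite sclassD (_ : sclass (a *: f') = a *: sclass f'); last exact: sclassZ.
  by rewrite linearP.
move=> f pf; pose f' := SElt (mem_set pf : f \in sdom_pred p).
by rewrite (LE f') -(squot_normE f').
Qed.

Lemma contractive_lift L : contractive L -> exists F : {linear squot p -> R^o},
  (forall f : selt p, F (sclass f) = L (selt_val f)) /\
  (forall x, `|F x| <= `|x|).
Proof.
move=> [Llin L1]; pose F (x : squot p) : R^o := L (selt_val (srepr x)).
have FE (f : selt p) : F (sclass f) = L (selt_val f).
  have := sclass_srepr f; rewrite unfold_in => /eqP f0.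
  have := L1 _ (seltP (srepr (sclass f) - f)); rewrite f0 normr_le0 => /eqP L0.
  have := Llin 1 _ _ (seltP (srepr (sclass f) - f)) (seltP f).
  by rewrite L0 mulr0 add0r scale1r /= subrK.
have Flin : linear F.
  move=> a x y; rewrite -(sreprK x) -(sreprK y).
  rewrite (_ : a *: _ = sclass (a *: srepr x)); last by rewrite sclassZ.
  rewrite -sclassD !FE; exact: Llin (seltP _) (seltP _).
pose G : {linear squot p -> R^o} := HB.pack F
  (GRing.isLinear.Build R (squot p) R^o *:%R F Flin).
exists G; split=> [//|x].
by rewrite -(sreprK x) squot_normE /= FE; apply: L1; exact: seltP.
Qed.

Lemma luacs_plus_raw (x : V) (u : nat -> V) L : luacs_plus (squot p) ->
    sdom p x -> snorm p x = 1 ->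
    (forall n, sdom p (u n)) -> (forall n, snorm p (u n) <= 1) ->
    (fun n => snorm p (u n + x)) @ \oo --> (2 : R) -> contractive L ->
  (fun n => L (u n)) @ \oo --> (1 : R) <-> L x = 1.
Proof.
move=> lp px x1 pu u1 ux /contractive_lift[F [FL F1]].
pose x' := SElt (mem_set px : x \in sdom_pred p).
pose u' n := SElt (mem_set (pu n) : u n \in sdom_pred p).
rewrite -[L x](FL x') (_ : (fun n => L (u n)) = fun n => F (sclass (u' n))).
  apply: (luacs_plus_ball lp) => //.
  - by rewrite squot_normE; exact: x1.
  - by move=> n; rewrite squot_normE; exact: u1.
  - by under eq_fun do rewrite -sclassD squot_normE; exact: ux.
by apply/funext => n; rewrite FL.
Qed.

End RawFunctionals.

(** * Attainment at a single point of the sphere *)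

Section Pointwise.
Context {R : realType} (X : normedModType R).

(** Both sides are continuous in the coefficients. The rational form is the one
    that can hold simultaneously outside a null set. *)
Lemma rational_combinations (C : R) (z : nat -> X) (g : nat -> R) : 0 <= C ->
    (forall s : seq rat, \sum_(i < size s) ratr s`_i * g i <=
       C * `|\sum_(i < size s) (ratr s`_i : R) *: z i|) ->
  forall (c : nat -> R) N,
    \sum_(i < N) c i * g i <= C * `|\sum_(i < N) c i *: z i|.
Proof.
move=> C0 H c N; pose K := \sum_(i < N) (`|g i| + C * `|z i|).
have K0 : 0 <= K by apply: sumr_ge0 => i _; rewrite addr_ge0// mulr_ge0.
apply/ler_addgt0Pr => e e0.
(* With coefficients moved by at most dl, the two sides change by at most
   dl * K <= e in total. *)
pose dl := e / (K + 1).
have dl0 : 0 < dl by rewrite divr_gt0// ltr_wpDl.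
have : forall i, exists q : rat, `|c i - ratr q| <= dl.
  move=> i; have [q] := @rat_in_itvoo R (c i - dl) (c i + dl) ltac:(lra).
  rewrite in_itv /= => /andP[q1 q2]; exists q.
  by rewrite ler_norml; apply/andP; split; lra.
move=> /choice[q qc].
have := H (mkseq q N); rewrite size_mkseq.
rewrite (eq_bigr (fun i : 'I_N => ratr (q i) * g i)); last first.
  by move=> i _; rewrite nth_mkseq.
rewrite [X in _ * `|X|](eq_bigr (fun i : 'I_N => (ratr (q i) : R) *: z i)); last first.
  by move=> i _; rewrite nth_mkseq.
set A := \sum_(i < N) _; set B := \sum_(i < N) _ => AB.
have h1 : \sum_(i < N) c i * g i - A <= \sum_(i < N) dl * `|g i|.
  rewrite /A -sumrB; apply: ler_sum => i _; rewrite -mulrBl.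
  by rewrite (le_trans (ler_norm _))// normrM ler_wpM2r.
have h2 : `|B - \sum_(i < N) c i *: z i| <= \sum_(i < N) dl * `|z i|.
  rewrite /B -sumrB; apply: le_trans (ler_norm_sum _ _ _) _.
  by apply: ler_sum => i _; rewrite -scalerBl normrZ distrC ler_wpM2r.
have h3 : `|B| <= `|B - \sum_(i < N) c i *: z i| + `|\sum_(i < N) c i *: z i|.
  by rewrite (le_trans _ (ler_normD _ _))// subrK.
have h4 : dl * K <= e.
  by rewrite /dl mulrAC ler_pdivrMr ?ltr_wpDl// mulrDr mulr1 lerDl ltW.
have h5 : dl * K = \sum_(i < N) dl * `|g i| + C * \sum_(i < N) dl * `|z i|.
  rewrite /K mulr_sumr mulr_sumr -big_split /=; apply: eq_bigr => i _.
  by rewrite mulrDr mulrCA.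
have h6 : C * `|B| <= C * (\sum_(i < N) dl * `|z i| + `|\sum_(i < N) c i *: z i|).
  by rewrite ler_wpM2l// (le_trans h3)// lerD2r.
by rewrite mulrDr in h6; lra.
Qed.

(** Helly's theorem, with no restriction on the number of points: the cone of
    all pairs (combination of the [z i], same combination of the [g i]) lies
    below [C * `|x|]. *)
Lemma interpolation (C : R) (z : nat -> X) (g : nat -> R) : 0 <= C ->
    (forall (c : nat -> R) N,
      \sum_(i < N) c i * g i <= C * `|\sum_(i < N) c i *: z i|) ->
  exists f : {linear X -> R^o},
    (forall x, `|f x| <= C * `|x|) /\ forall i, f (z i) = g i.
Proof.
move=> C0 H.
pose supp (c : nat -> R) N := forall i, (N <= i)%N -> c i = 0.
pose G (v : X) (r : R) := exists (c : nat -> R) N, supp c N /\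
  (v = \sum_(i < N) c i *: z i /\ r = \sum_(i < N) c i * g i).
have widen (W : lmodType R) (w : nat -> W) c N M : supp c N -> (N <= M)%N ->
    \sum_(i < N) c i *: w i = \sum_(i < M) c i *: w i.
  move=> cN NM; rewrite (big_ord_widen _ (fun i => c i *: w i) NM).
  rewrite [LHS]big_mkcond; apply: eq_bigr => i _.
  by case: ltnP => // /cN ->; rewrite scale0r.
have [||v r|f [fp fG]] := @sandwich R X (fun x => C * `|x|) G.
- split=> [x y|a x a0]; first by rewrite -mulrDr ler_wpM2l// ler_normD.
  by rewrite normrZ ger0_norm// mulrCA.
- split.
  + by exists (fun=> 0), 0%N; split=> //; rewrite !big_ord0.
  + move=> _ _ _ _ [c [N [cN [-> ->]]]] [c' [N' [cN' [-> ->]]]].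
    exists (fun i => c i + c' i), (maxn N N'); split.
      move=> i; rewrite geq_max => /andP[Ni Ni'].
      by rewrite cN// cN'// addr0.
    have NM := leq_maxl N N'; have NM' := leq_maxr N N'.
    split.
      rewrite (widen _ z _ _ _ cN NM) (widen _ z _ _ _ cN' NM') -big_split /=.
      by apply: eq_bigr => i _; rewrite scalerDl.
    rewrite (widen R^o g _ _ _ cN NM) (widen R^o g _ _ _ cN' NM') -big_split /=.
    by apply: eq_bigr => i _; rewrite mulrDl.
  + move=> a _ _ a0 [c [N [cN [-> ->]]]].
    exists (fun i => a * c i), N; split; first by move=> i /cN ->; rewrite mulr0.
    split; rewrite ?scaler_sumr ?mulr_sumr; apply: eq_bigr => i _.
      by rewrite scalerA.
    by rewrite mulrA.
- by move=> [c [N [_ [-> ->]]]]; exact: H.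
exists f; split=> [x|i].
  rewrite ler_norml fp andbT lerNl.
  by rewrite -linearN (le_trans (fp _))// normrN.
(* Used for a = 1 and a = -1, which bound f (z i) from both sides. *)
have Gi (a : R) : G (a *: z i) (a * g i).
  exists (fun j => if j == i then a else 0), i.+1; split.
    by move=> j ij; rewrite gtn_eqF.
  rewrite !big_ord_recr /= eqxx.
  rewrite !big1 ?add0r// => j _.
    by rewrite ltn_eqF// mul0r.
  by rewrite ltn_eqF// scale0r.
apply/le_anti/andP; split.
  have := fG _ _ (Gi (-1)); rewrite linearZ /= => h.
  by rewrite -lerN2 -mulN1r -[leRHS]mulN1r.
by have := fG _ _ (Gi 1); rewrite scale1r mul1r.
Qed.

(** If [`|a| <= `|v|], replace [`|v|^-1] by the larger [`|a|^-1] at the cost of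
    the difference of the two times [`|v|]. *)
Lemma normalized_sum_norm (a v : X) : a != 0 -> v != 0 ->
  2 - `| `|v|^-1 *: v + `|a|^-1 *: a | <=
    (`|v|^-1 + `|a|^-1) * (`|v| + `|a| - `|v + a|).
Proof.
wlog av : a v / `|a| <= `|v| => [H a0 v0|a0 v0].
  have [/H|/ltW/H] := leP `|a| `|v|; first by apply.
  move=> /(_ v0 a0).
  by rewrite (addrC (_ *: v)) (addrC `|v|^-1) (addrC `|v| `|a|) (addrC v a).
have na : 0 < `|a| by rewrite normr_gt0.
have nv : 0 < `|v| by rewrite normr_gt0.
set al := `|a|^-1; set be := `|v|^-1.
have al0 : 0 < al by rewrite invr_gt0.
have be0 : 0 < be by rewrite invr_gt0.
have bea : be <= al by rewrite lef_pV2.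
have ala : al * `|a| = 1 by rewrite mulVf// gt_eqF.
have bev : be * `|v| = 1 by rewrite mulVf// gt_eqF.
have h : al * `|v + a| <= `|be *: v + al *: a| + (al - be) * `|v|.
  have -> : al * `|v + a| = `|al *: (v + a)|.
    by rewrite normrZ (ger0_norm (ltW al0)).
  have -> : (al - be) * `|v| = `|(al - be) *: v|.
    by rewrite normrZ ger0_norm// subr_ge0.
  rewrite (le_trans _ (ler_normD _ _))// scalerBl scalerDr.
  by rewrite [in leRHS]addrC addrA subrK.
have tri := ler_normD v a.
have : 0 <= be * (`|v| + `|a| - `|v + a|) by rewrite mulr_ge0 ?subr_ge0 ?(ltW be0).
by nra.
Qed.

(** The lower bound [dl] turns the two defects of [v n] into defects of the
    normalized vector, so that luacs applies to [C^-1 *: f], which lies on the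
    dual sphere because it tends to 1 along the normalized sequence. *)
Lemma luacs_functional (f : {linear X -> R^o}) (C dl : R) (a : X) (v : nat -> X) :
    luacs X -> 0 < C -> 0 < dl -> a != 0 ->
    (forall x, `|f x| <= C * `|x|) -> (forall n, dl <= `|v n|) ->
    (fun n => `|v n| - Num.max 0 (`|v n + a| - `|a|)) @ \oo --> (0 : R) ->
    (fun n => C * `|v n| - f (v n)) @ \oo --> (0 : R) ->
  f a = C * `|a|.
Proof.
move=> lX C0 dl0 a0 fC dlv va fv.
have v0 n : v n != 0 by rewrite -normr_gt0 (lt_le_trans dl0).
have na : 0 < `|a| by rewrite normr_gt0.
have nv n : 0 < `|v n| by rewrite normr_gt0.
have sphere (y : X) : y != 0 -> unit_sphere (`|y|^-1 *: y).
  move=> y0; rewrite /unit_sphere /= normrZ ger0_norm ?invr_ge0//.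
  by rewrite mulVf ?normr_eq0.
pose u n := `|v n|^-1 *: v n.
pose h : {linear X -> R^o} := (C^-1 : R) \*: f.
have hE x : h x = C^-1 * f x by [].
have h1 x : `|h x| <= `|x|.
  by rewrite hE normrM ger0_norm ?invr_ge0 ?(ltW C0)// ler_pdivrMl.
have hu : (fun n => h (u n)) @ \oo --> (1 : R^o).
  have fv' : (fun n => (C * dl)^-1 * (C * `|v n| - f (v n))) @ \oo --> (0 : R).
    by rewrite -[X in _ --> X](mulr0 (C * dl)^-1); apply: cvgZr.
  apply: (fun H => @cvg_dominated _ _ _ (1 : R) H fv') => n.
  have fvn : f (v n) <= C * `|v n| by rewrite (le_trans (ler_norm _)).
  rewrite hE /u linearZ /=.
  have -> : C^-1 * (`|v n|^-1 * f (v n)) - 1 =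
      - ((C * `|v n|)^-1 * (C * `|v n| - f (v n))).
    by field; rewrite ?gt_eqF.
  rewrite normrN ger0_norm; last first.
    by rewrite mulr_ge0 ?subr_ge0// invr_ge0 mulr_ge0// ltW.
  by rewrite ler_wpM2r ?subr_ge0// lef_pV2 ?ler_pM2l ?posrE ?mulr_gt0.
have ux : (fun n => `|u n + `|a|^-1 *: a|) @ \oo --> (2 : R).
  (* The factor 2 covers the indices where the maximum is 0; there the defect
     is all of |v n| >= dl, while the left-hand side is at most 2. *)
  pose K := 2 * (dl^-1 + `|a|^-1).
  have va' : (fun n => K * (`|v n| - Num.max 0 (`|v n + a| - `|a|))) @ \oo --> (0 : R).
    by rewrite -[X in _ --> X](mulr0 K); apply: cvgZr.
  apply: (fun H => @cvg_dominated _ _ _ _ H va') => n.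
  have le2 : `|u n + `|a|^-1 *: a| <= 2.
    by rewrite (le_trans (ler_normD _ _))// !sphere// (_ : 1 + 1 = 2 :> R).
  rewrite ler0_norm; last by rewrite subr_le0.
  rewrite opprB.
  have dlV : `|v n|^-1 <= dl^-1 by rewrite lef_pV2 ?posrE.
  have dlp : 0 < dl^-1 by rewrite invr_gt0.
  have ap : 0 < `|a|^-1 by rewrite invr_gt0.
  have dl1 : 1 <= dl^-1 * `|v n|.
    by rewrite mulrC ler_pdivlMr// mul1r.
  have [neg|pos] := leP (`|v n + a| - `|a|) 0.
    rewrite subr0 /K; have := normr_ge0 (u n + `|a|^-1 *: a).
    have : 0 <= `|a|^-1 * `|v n| by rewrite mulr_ge0.
    by nra.
  have := normalized_sum_norm a0 (v0 n).
  have tri := ler_normD (v n) a.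
  rewrite -/(u n) /K; set e := `|v n| + _ - _.
  have -> : `|v n| - (`|v n + a| - `|a|) = e by rewrite /e opprB addrA.
  have e0 : 0 <= e by rewrite subr_ge0.
  have : (`|v n|^-1 + `|a|^-1) * e <= (dl^-1 + `|a|^-1) * e.
    by rewrite ler_wpM2r// lerD2r.
  have : 0 <= (dl^-1 + `|a|^-1) * e by rewrite mulr_ge0// addr_ge0// ltW.
  by lra.
have hS : dual_sphere h.
  by apply: dual_sphereI hu => // n; rewrite (sphere _ (v0 n)).
have := lX _ u h (sphere _ a0) (fun n => sphere _ (v0 n)) hS ux hu.
rewrite hE linearZ /= mulrA -invfM => h2.
have Ca0 : C * `|a| != 0 by rewrite gt_eqF// mulr_gt0.
by apply: (mulfI (invr_neq0 Ca0)); rewrite h2 mulVf.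
Qed.

(** What happens at one point [t] of the measure space: [a] and [v n] are the
    values of the limit function and of the sequence in E(X), [g0] and [g n]
    those of their densities, [C] is [(w t)^-1], and [q] is a common bound for
    the defects of [v n]. *)
Lemma pointwise_attainment (C : R) (a : X) (v : nat -> X) (g0 : R) (g q : nat -> R) :
    luacs X -> 0 < C ->
    (forall s : seq rat,
      \sum_(i < size s) ratr s`_i * (if i : nat is n.+1 then g n else g0) <=
      C * `|\sum_(i < size s) (ratr s`_i : R) *: (if i : nat is n.+1 then v n else a)|) ->
    (forall n, `|v n| - Num.max 0 (`|v n + a| - `|a|) <= q n) ->
    (forall n, `|C * `|v n| - g n| <= q n) ->
    q @ \oo --> (0 : R) ->
    ((fun n => `|v n|) @ \oo --> (0 : R) -> `|a| = 0) ->
  g0 = C * `|a|.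
Proof.
move=> lX C0 comb qv qg q0 van.
have [f [fC fE]] := interpolation (ltW C0) (rational_combinations (ltW C0)
  (z := fun i => if i is n.+1 then v n else a)
  (g := fun i => if i is n.+1 then g n else g0) comb).
have fa : f a = g0 := fE 0%N.
have fv n : f (v n) = g n := fE n.+1.
have [a0|a0] := eqVneq a 0.
  by rewrite -fa a0 linear0 normr0 mulr0.
have [|dl [s [dl0 hs]]] := not_cvg0_subsequence (fun n => normr_ge0 (v n)).
  by move=> /van /eqP; rewrite normr_eq0 (negPf a0).
have sn n : (n <= s n)%N by have [] := hs n.
have qs := cvg_subsequence sn q0.
rewrite -fa; apply: (@luacs_functional f C dl a (fun n => v (s n))) => //.
- by move=> n; have [] := hs n.
- apply: (fun H => @cvg_dominated _ _ _ _ H qs) => n.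
  rewrite subr0 ger0_norm//; have := ler_normD (v (s n)) a => tri.
  by rewrite subr_ge0 ge_max normr_ge0 lerBlDr.
- by apply: (fun H => @cvg_dominated _ _ _ _ H qs) => n; rewrite subr0 fv.
Qed.

End Pointwise.

(** * Densities of countably additive set functions *)

Section MeasureTools.
Context d (S : measurableType d) (R : realType).
Implicit Types (m : {measure set S -> \bar R}) (T : set S -> R).

Lemma measurable_gt (f : S -> R) (c : R) :
  measurable_fun setT f -> measurable [set t | c < f t].
Proof.
move=> mf; have := mf measurableT _ (measurable_itv `]c, +oo[).
rewrite setTI; congr measurable.
by apply/seteqP; split=> t /=; rewrite in_itv /= andbT.
Qed.

Lemma measurable_cvg0 (u : nat -> S -> R) :
    (forall n, measurable_fun setT (u n)) -> (forall n t, 0 <= u n t) ->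
  measurable [set t | u^~ t @ \oo --> (0 : R)].
Proof.
move=> meas_u u0.
have -> : [set t | u^~ t @ \oo --> (0 : R)] =
    \bigcap_k \bigcup_N \bigcap_(n in [set n | (N <= n)%N])
      ~` [set t | k.+1%:R^-1 < u n t].
  apply/seteqP; split=> [t /= ut k _|t ut].
    have /cvgr0Pnorm_lt/(_ k.+1%:R^-1) := ut.
    rewrite invr_gt0 ltr0n => /(_ isT)[N _ hN]; exists N => // n /= Nn.
    apply/negP; rewrite -leNgt; apply/ltW.
    by have := hN n Nn; rewrite ger0_norm.
  apply/cvgr0Pnorm_le => e e0.
  have [k _ ke] : exists2 k, True & (k.+1%:R^-1 : R) <= e.
    exists (Num.trunc e^-1) => //; rewrite invf_ple ?posrE//.
    exact/ltW/truncnS_gt.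
  have [N _ hN] := ut k I; exists N => // n /= Nn.
  rewrite ger0_norm//; apply: le_trans ke.
  by have /negP := hN n Nn; rewrite -leNgt.
apply: bigcapT_measurable => k; apply: bigcupT_measurable => N.
apply: bigcap_measurableType => n _; apply: measurableC.
exact: measurable_gt.
Qed.

(** On the set where [g < f] the integral of [f - g] is at most 0. *)
Lemma ae_le_of_integrals m (f g : S -> R) :
    m.-integrable setT (EFin \o f) -> m.-integrable setT (EFin \o g) ->
    (forall A, measurable A ->
      \int[m]_(t in A) f t <= \int[m]_(t in A) g t) ->
  \forall t \ae m, f t <= g t.
Proof.
move=> If Ig fg; pose h t := f t - g t.
have Ih : m.-integrable setT (EFin \o h) by exact: (integrableB measurableT If Ig).
have mh : measurable_fun setT h by apply/measurable_EFinP; exact: measurable_int Ih.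
pose A := [set t | 0 < h t].
have mA : measurable A by exact: measurable_gt.
have sub := @integrableS _ _ _ m setT A _ measurableT mA (@subsetT _ A).
have h0 : (\int[m]_(t in A) `|(h t)%:E| = 0)%E.
  have -> : (\int[m]_(t in A) `|(h t)%:E| = \int[m]_(t in A) (h t)%:E)%E.
    by apply: eq_integral => t /set_mem At; rewrite gee0_abs// lee_fin ltW.
  have hA : \int[m]_(t in A) h t <= 0.
    by rewrite RintegralB ?subr_le0; [exact: fg|exact: mA|exact: sub If|exact: sub Ig].
  apply/le_anti/andP; split; last first.
    by apply: integral_ge0 => t At; rewrite lee_fin ltW.
  rewrite -[leLHS]fineK; first by rewrite lee_fin.
  exact: (integrable_fin_num mA (sub _ Ih)).
have mhA : measurable_fun A (EFin \o h) by exact: measurable_int (sub _ Ih).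
have := (ae_eq_integral_abs m mA mhA).1 h0; apply: filterS => t ht.
rewrite leNgt; apply/negP => gf.
have At : A t by rewrite /A /h /= subr_gt0.
by have [hE] := ht At; move: At; rewrite /A /= hE ltxx.
Qed.

(** Choose [s n] so that the integrals are summable; the series of the [q (s n)]
    is then integrable, hence finite almost everywhere. *)
Lemma L1_subsequence m (q : nat -> S -> R) :
    (forall n, measurable_fun setT (q n)) -> (forall n t, 0 <= q n t) ->
    (forall e : R, 0 < e -> exists N, forall n, (N <= n)%N ->
      (\int[m]_t (q n t)%:E < e%:E)%E) ->
  exists s : nat -> nat, (forall n, (n <= s n)%N) /\
    \forall t \ae m, (fun n => q (s n) t) @ \oo --> (0 : R).
Proof.
move=> mq q0 qe.
have : forall k, exists n, (k <= n)%N /\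
    (\int[m]_t (q n t)%:E <= (1 / (2 ^ k.+1)%:R)%:E)%E.
  move=> k; have [|N hN] := qe (1 / (2 ^ k.+1)%:R).
    by rewrite divr_gt0// ltr0n expn_gt0.
  exists (maxn k N); rewrite leq_maxl; split => //.
  by apply/ltW/hN; exact: leq_maxr.
move=> /choice[s sP]; exists s; split; first by move=> n; have [] := sP n.
have mE n : measurable_fun setT (fun t => (q (s n) t)%:E).
  by apply/measurable_EFinP; exact: mq.
have E0 n t : setT t -> (0 <= (q (s n) t)%:E)%E by rewrite lee_fin.
have sumI : m.-integrable setT (fun t => \sum_(n <oo) (q (s n) t)%:E)%E.
  apply/integrableP; split.
    apply: ge0_emeasurable_sum => [k t _ _|k _]; first by rewrite lee_fin.
    exact: mE.
  have -> : (\int[m]_t `|\sum_(n <oo) (q (s n) t)%:E| =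
      \int[m]_t \sum_(n <oo) (q (s n) t)%:E)%E.
    apply: eq_integral => t _; rewrite gee0_abs// nneseries_ge0// => n _ _.
    exact: E0.
  rewrite integral_nneseries//.
  apply: (@le_lt_trans _ _ (\sum_(n <oo) (1 / (2 ^ n.+1)%:R)%:E)%E).
    apply: lee_nneseries => [n _ _|n _]; first by apply: integral_ge0 => t; exact: E0.
    by have [] := sP n.
  by apply: le_lt_trans (epsilon_trick0 xpredT ler01) _; rewrite ltry.
have := integrable_ae measurableT sumI; apply: filterS => t /(_ I) tfin.
apply: cvg_series_cvg_0; apply: nondecreasing_is_cvgn.
  by apply: nondecreasing_series => n _ _; exact: q0.
exists (fine (\sum_(n <oo) (q (s n) t)%:E)%E) => _ [n _ <-].
rewrite -lee_fin fineK// /series /= -sumEFin.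
by apply: nneseries_lim_ge => k _ _; rewrite lee_fin.
Qed.

Definition countably_additive T : Prop :=
  forall F : nat -> set S, (forall i, measurable (F i)) -> trivIset setT F ->
  (fun n => \sum_(0 <= i < n) T (F i)) @ \oo --> T (\bigcup_i F i).

Lemma countably_additive_EFin T : countably_additive T ->
  semi_sigma_additive (fun A => (T A)%:E).
Proof.
move=> TT F mF tF _; under eq_fun do rewrite sumEFin.
by apply: cvg_EFin; [exact: nearW|exact: TT].
Qed.

Lemma finite_measure_of T : T set0 = 0 ->
    (forall A, measurable A -> 0 <= T A) -> countably_additive T ->
  exists m : {finite_measure set S -> \bar R},
    forall A, measurable A -> m A = (T A)%:E.
Proof.
(* A measure is nonnegative on all sets; the absolute value takes care of the
   non-measurable ones. *)
move=> T0 Tge0 TT; pose m0 A := (`|T A|)%:E : \bar R.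
have m00 : m0 set0 = 0%E by rewrite /m0 T0 normr0.
have m0ge A : (0 <= m0 A)%E by rewrite lee_fin.
have m0s : semi_sigma_additive m0.
  apply: countably_additive_EFin => F mF tF.
  rewrite ger0_norm ?Tge0//; last exact: bigcup_measurable.
  under eq_fun do under eq_bigr do rewrite ger0_norm ?Tge0//.
  exact: TT.
have m0f : fin_num_fun m0 by [].
pose m1 : {measure set S -> \bar R} := HB.pack m0
  (isMeasure.Build d S R m0 m00 m0ge m0s).
pose m : {finite_measure set S -> \bar R} := HB.pack (Measure.sort m1)
  (Measure_isFinite.Build d S R (Measure.sort m1) m0f).
by exists m => A mA; rewrite /= /m0 ger0_norm ?Tge0.
Qed.

(** Domination by the integrals of [k] gives absolute continuity, and the
    Radon-Nikodym theorem applies. *)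
Lemma density_of_dominated (m : {finite_measure set S -> \bar R}) T (k : S -> R) :
    T set0 = 0 -> countably_additive T -> measurable_fun setT k ->
    (forall A, measurable A -> `|T A| <= \int[m]_(t in A) k t) ->
  exists g : S -> R, m.-integrable setT (EFin \o g) /\
    forall A, measurable A -> T A = \int[m]_(t in A) g t.
Proof.
move=> T0 TT mk Tk; pose nu0 A := (T A)%:E : \bar R.
have nu00 : nu0 set0 = 0%E by rewrite /nu0 T0.
pose nu : {charge set S -> \bar R} := HB.pack nu0
  (isCharge.Build d S R nu0 nu00 (fun _ _ => isT) (countably_additive_EFin TT)).
have dom : nu `<< m.
  apply/null_content_dominatesP => A mA mA0.
  rewrite /= /nu0; congr EFin; apply/eqP; rewrite -normr_le0.
  rewrite (le_trans (Tk A mA))//.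
  rewrite /Rintegral (null_set_integral mA _ mA0)//.
  by apply/measurable_EFinP; apply: measurable_funTS.
have fin t := Radon_Nikodym_fin_num t dom.
have Ig : m.-integrable setT (EFin \o (fine \o Radon_Nikodym nu m)).
  apply: eq_integrable (Radon_Nikodym_integrable dom) => // t _.
  by rewrite /= fineK.
exists (fine \o Radon_Nikodym nu m); split=> [//|A mA]; apply: EFin_inj.
rewrite -[LHS]/(nu A) (Radon_Nikodym_integral dom mA) /Rintegral fineK.
  by apply: eq_integral => t _; rewrite /= fineK.
apply: (integrable_fin_num mA); exact: integrableS Ig.
Qed.

End MeasureTools.

(** * Köthe function spaces *)

Section KoetheFunctionals.
Context d (S : measurableType d) (R : realType).
Variable mu : {measure set S -> \bar R}.
Variable E : koethe mu.
Implicit Types (x y w : S -> R) (A : set S) (L : (S -> R^o) -> R).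

Let p := koethe_seminormed E.

Lemma kset_le x y : kset E x -> measurable_fun setT y ->
  (forall t, `|y t| <= `|x t|) -> kset E y /\ knorm E y <= knorm E x.
Proof. by move=> Ex my yx; apply: kideal => //; exact: aeW. Qed.

Lemma ksetD x y : kset E x -> kset E y -> kset E (fun t => x t + y t).
Proof.
move=> Ex Ey; rewrite (_ : (fun t => _) = (fun t => 1 * x t + y t)).
  exact: ksetP.
by apply/funext => t; rewrite mul1r.
Qed.

Lemma ksetZ (a : R) x : kset E x -> kset E (fun t => a * x t).
Proof.
move=> Ex; rewrite (_ : (fun t => _) = (fun t => a * x t + 0)).
  by apply: ksetP => //; exact: kset0.
by apply/funext => t; rewrite addr0.
Qed.

Lemma ksetB x y : kset E x -> kset E y -> kset E (fun t => x t - y t).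
Proof.
move=> Ex Ey; rewrite (_ : (fun t => _) = (fun t => -1 * y t + x t)).
  exact: ksetP.
by apply/funext => t; rewrite mulN1r addrC.
Qed.

Lemma kset_restrict A x : measurable A -> kset E x ->
  kset E (fun t => \1_A t * x t) /\ knorm E (fun t => \1_A t * x t) <= knorm E x.
Proof.
move=> mA Ex; apply: kset_le => //.
  by apply: measurable_funM; [exact: measurable_indic|exact: kmeasurable Ex].
move=> t; rewrite normrM ler_piMl// indicE.
by case: (t \in A); rewrite ?normr1// normr0.
Qed.

Lemma knorm_ge0 x : kset E x -> 0 <= knorm E x.
Proof. exact: (@snorm_ge0 _ _ p). Qed.

Lemma knorm0 : knorm E (fun=> 0) = 0.
Proof. exact: (snorm0 p). Qed.

Lemma kset_pos x : kset E x ->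
  kset E (fun t => Num.max 0 (x t)) /\
  knorm E (fun t => Num.max 0 (x t)) <= knorm E x.
Proof.
move=> Ex; apply: kset_le => //.
  apply: measurable_maxr => //; exact: kmeasurable Ex.
move=> t; rewrite ger0_norm; last by rewrite le_max lexx.
by rewrite ge_max normr_ge0 ler_norm.
Qed.

Lemma knorm_le x y : kset E x -> kset E y ->
  (forall t, `|y t| <= `|x t|) -> knorm E y <= knorm E x.
Proof.
by move=> Ex Ey yx; apply: (kset_le Ex _ yx).2; exact: kmeasurable Ey.
Qed.

(** The infimum of a decreasing sequence is its pointwise limit. *)
Lemma order_continuous_seq (u : nat -> S -> R) :
    koethe_order_continuous E -> (forall n, kset E (u n)) ->
    (forall n t, 0 <= u n t) ->
    (forall t, {homo u^~ t : m n / (m <= n)%N >-> n <= m}) ->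
    (forall t, u^~ t @ \oo --> (0 : R)) ->
  (fun n => knorm E (u n)) @ \oo --> (0 : R).
Proof.
move=> ocE Eu u0 udec ucvg.
apply/cvgr0Pnorm_lt => e e0.
have [||||||||n un] := ocE nat (fun i j => (i <= j)%N) u _ _ _ _ _ _ _ _ e e0.
- exact: inhabits 0%N.
- by move=> i.
- by move=> i j k; exact: leq_trans.
- by move=> i j; exists (maxn i j); rewrite ?leq_maxl ?leq_maxr.
- by move=> i; exact: Eu.
- by move=> i j ij; apply: aeW => t; exact: udec.
- by move=> i; apply: aeW => t; exact: u0.
- move=> h Eh hu; have /(@ae_foralln _ _ _ mu) := hu; apply: filterS => t ht.
  exact: cvg_geR (ucvg t) ht.
by exists n => // m nm /=; rewrite ger0_norm ?un//; exact: knorm_ge0.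
Qed.

Lemma contractiveD L x y : contractive p L -> kset E x -> kset E y ->
  L (fun t => x t + y t) = L x + L y.
Proof.
move=> [Llin _] Ex Ey; rewrite -[L x]mul1r -(Llin 1 x y Ex Ey).
by congr L; apply/funext => t; rewrite !fctE /= [_ *: _]mul1r.
Qed.

Lemma contractive0 L : contractive p L -> L (fun=> 0) = 0.
Proof.
move=> [_ L1]; apply/eqP; rewrite -normr_le0.
by apply: le_trans (L1 _ (kset0 E)) _; rewrite [snorm p _]knorm0.
Qed.

Lemma contractiveZ L (a : R) x : contractive p L -> kset E x ->
  L (fun t => a * x t) = a * L x.
Proof.
move=> cL Ex; have [Llin _] := cL.
rewrite -[RHS]addr0 -(contractive0 cL) -(Llin a x _ Ex (kset0 E)).
by congr L; apply/funext => t; rewrite !fctE /= addr0.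
Qed.

Lemma contractiveB L x y : contractive p L -> kset E x -> kset E y ->
  L (fun t => x t - y t) = L x - L y.
Proof.
move=> cL Ex Ey; rewrite -mulN1r -(contractiveZ _ cL Ey).
rewrite -contractiveD//; last exact: ksetZ.
by congr L; apply/funext => t; rewrite mulN1r.
Qed.

Lemma contractive_le L x : contractive p L -> kset E x -> L x <= knorm E x.
Proof. by move=> [_ L1] Ex; exact: le_trans (ler_norm _) (L1 x Ex). Qed.

Lemma contractive_sum (I : Type) (r : seq I) (c : I -> R) (f : I -> S -> R) L :
    contractive p L -> (forall i, kset E (f i)) ->
  kset E (fun t => \sum_(i <- r) c i * f i t) /\
  L (fun t => \sum_(i <- r) c i * f i t) = \sum_(i <- r) c i * L (f i).
Proof.
move=> cL Ef; elim: r => [|i r [IH1 IH2]].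
  under eq_fun do rewrite big_nil.
  by rewrite big_nil contractive0//; split => //; exact: kset0.
under eq_fun do rewrite big_cons.
split; first by apply: ksetD IH1; exact: ksetZ.
by rewrite big_cons contractiveD ?IH2 ?contractiveZ//; exact: ksetZ.
Qed.

(** The error after [n] terms is the value of [T] on the union of the remaining
    sets. These decrease to the empty set, so order continuity makes the norms
    of the restrictions of [x] to them tend to 0. *)
Lemma sigma_additive_dominated x (T : set S -> R) : koethe_order_continuous E ->
    kset E x -> (forall t, 0 <= x t) ->
    (forall A B, measurable A -> measurable B -> A `&` B = set0 ->
      T (A `|` B) = T A + T B) ->
    (forall A, measurable A -> `|T A| <= knorm E (fun t => \1_A t * x t)) ->
  countably_additive T.
Proof.
move=> ocE Ex x0 TU Tx F mF tF.
pose tail n := \bigcup_(i in [set i | (n <= i)%N]) F i.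
have mtail n : measurable (tail n) by exact: bigcup_measurable.
have tailS n : tail n = F n `|` tail n.+1.
  apply/seteqP; split=> [t [i /= ni Fit]|t [Fnt|[i /= ni Fit]]].
  - move: ni; rewrite leq_eqVlt => /predU1P[->|ni]; first by left.
    by right; exists i.
  - by exists n => /=.
  - by exists i => //=; exact: ltnW.
have tail_decr t m n : (m <= n)%N -> tail n t -> tail m t.
  by move=> mn [i /= ni Fit]; exists i => //=; exact: leq_trans ni.
have tail0 t : exists N, forall n, (N <= n)%N -> ~ tail n t.
  have [[i Fit]|nF] := pselect (exists i, F i t); last first.
    by exists 0%N => n _ [i _ Fit]; apply: nF; exists i.
  exists i.+1 => n ni [j /= nj Fjt].
  have ij : i = j by apply: tF => //; exists t.
  by move: nj; rewrite -ij leqNgt ni.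
have TE n : T (\bigcup_i F i) - \sum_(0 <= i < n) T (F i) = T (tail n).
  elim: n => [|n IH].
    rewrite big_nil subr0; congr T.
    by apply/seteqP; split=> t [i _ Fit]; exists i.
  rewrite big_nat_recr//= opprD addrA IH tailS TU//.
    by rewrite addrAC subrr add0r.
  rewrite -subset0 => t [Fnt [i /= ni Fit]].
  have ni' : n = i by apply: tF => //; exists t.
  by move: ni; rewrite ni' ltnn.
have tail_cvg : (fun n => knorm E (fun t => \1_(tail n) t * x t)) @ \oo --> (0 : R).
  apply: order_continuous_seq => //.
  - by move=> n; apply: (kset_restrict (mtail n) Ex).1.
  - by move=> n t; rewrite mulr_ge0.
  - move=> t m n mn; rewrite ler_wpM2r// !indicE.
    have [/set_mem tn|_] := boolP (t \in tail n); last by rewrite ler0n.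
    by rewrite mem_set//; exact: tail_decr tn.
  - move=> t; have [N tN] := tail0 t.
    apply: cvg_near_cst; exists N => // n /= Nn.
    by rewrite indicE memNset ?mul0r//; exact: tN.
apply: (fun H => @cvg_dominated _ _ _ _ H tail_cvg) => n.
by rewrite distrC TE; exact: Tx.
Qed.

Lemma knorm_sym x y : kset E x -> kset E y ->
  knorm E (fun t => x t - y t) = knorm E (fun t => y t - x t).
Proof.
move=> Ex Ey; rewrite -[RHS]mul1r -normrN1 -(knormZ _ (ksetB Ey Ex)).
by congr knorm; apply/funext => t; rewrite mulN1r opprB.
Qed.

(** A norm convergent series of multiples of the indicators of finite-measure
    sets covering the space. The limit dominates every partial sum almost
    everywhere, hence is positive almost everywhere; it is then corrected on
    the remaining null set. *)
Lemma weak_unit : sigma_finite setT mu ->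
  exists2 w, kset E w & forall t, 0 < w t.
Proof.
move=> [F FT mF].
have EF k : kset E (\1_(F k) : S -> R) by apply: kindic; have [] := mF k.
(* The k-th term has norm at most 2^-(k+1). *)
pose c k : R := 2^-1 ^+ k.+1 / (1 + knorm E \1_(F k)).
have nF k : 0 < 1 + knorm E (\1_(F k) : S -> R).
  by rewrite ltr_wpDr// knorm_ge0.
have c0 k : 0 < c k by rewrite divr_gt0// exprn_gt0.
pose s n t : R := \sum_(k < n) c k * \1_(F k) t.
have sS n t : s n.+1 t = s n t + c n * \1_(F n) t by rewrite /s big_ord_recr.
have Es n : kset E (s n).
  elim: n => [|n IH].
    rewrite (_ : s 0%N = fun=> 0); first exact: kset0.
    by apply/funext => t; rewrite /s big_ord0.
  rewrite (_ : s n.+1 = fun t => s n t + c n * \1_(F n) t).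
    by apply: ksetD IH _; apply: ksetZ.
  by apply/funext => t; rewrite sS.
have s_mono t m n : (m <= n)%N -> s m t <= s n t.
  elim: n => [|n IH]; first by rewrite leqn0 => /eqP ->.
  rewrite leq_eqVlt => /predU1P[->//|mn].
  rewrite (le_trans (IH mn))// sS lerDl mulr_ge0//.
  exact: ltW.
have half0 k : 0 < (2^-1 : R) ^+ k by rewrite exprn_gt0.
have s_cauchy m n : (m <= n)%N ->
    knorm E (fun t => s n t - s m t) <= 2^-1 ^+ m - 2^-1 ^+ n.
  elim: n => [|n IH].
    rewrite leqn0 => /eqP ->; rewrite subrr.
    by under eq_fun do rewrite subrr; rewrite knorm0.
  rewrite leq_eqVlt => /predU1P[->|mn].
    by rewrite subrr; under eq_fun do rewrite subrr; rewrite knorm0.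
  have -> : (fun t => s n.+1 t - s m t) =
      (fun t => (s n t - s m t) + c n * \1_(F n) t).
    by apply/funext => t; rewrite sS addrAC.
  apply: le_trans (knormD (ksetB (Es n) (Es m)) (ksetZ (c n) (EF n))) _.
  have h : knorm E (fun t => c n * \1_(F n) t) <= 2^-1 ^+ n.+1.
    rewrite (knormZ _ (EF n)) ger0_norm; last exact: ltW.
    by rewrite /c mulrAC ler_pdivrMr// ler_wpM2l ?lerDr// exprn_ge0.
  have := IH mn; rewrite exprS in h *; lra.
have half_cvg : (fun n => (2^-1 : R) ^+ n) @ \oo --> (0 : R).
  by apply: cvg_expr; rewrite ger0_norm// invf_lt1 ?ltr1n.
have [|v Ev sv] := @kcomplete _ _ _ _ E s Es.
  move=> e e0.
  have /cvgr0Pnorm_lt/(_ e e0)[N _ hN] := half_cvg.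
  have small m n : (N <= m)%N -> (m <= n)%N ->
      knorm E (fun t => s n t - s m t) < e.
    move=> Nm mn; apply: le_lt_trans (s_cauchy _ _ mn) _.
    have := hN m Nm; rewrite ger0_norm; last exact: ltW.
    by have := half0 n; lra.
  exists N => m n Nm Nn; have [mn|/ltnW nm] := leqP m n.
    by rewrite knorm_sym//; exact: small.
  exact: small.
have vs n : \forall t \ae mu, s n t <= v t.
  pose r t := Num.max 0 (s n t - v t).
  have [Er _] := kset_pos (ksetB (Es n) Ev).
  have r0 : knorm E r = 0.
    apply/le_anti; rewrite knorm_ge0// andbT.
    have svn : (fun k => knorm E (fun t => s (k + n)%N t - v t)) @ \oo --> (0 : R).
      by have := sv; rewrite -(cvg_shiftn n).
    apply: cvg_geR svn _ => k; apply: knorm_le => //; first exact: ksetB.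
    move=> t; rewrite ger0_norm ?le_max ?lexx// ge_max normr_ge0 /=.
    rewrite (le_trans _ (ler_norm _))// lerD2r.
    by apply: s_mono; exact: leq_addl.
  apply: filterS (knorm_eq0 Er r0) => t rt.
  by rewrite -subr_le0 -rt le_max lexx orbT.
have mv := kmeasurable Ev.
pose A := [set t | 0 < v t].
have mA : measurable A by exact: measurable_gt.
have mNA : measurable (~` A) by exact: measurableC.
exists (fun t => \1_A t * v t + \1_(~` A) t).
  apply: (knorm_ae Ev _ _).1.
    by apply: measurable_funD => //; apply: measurable_funM.
  have /(@ae_foralln _ _ _ mu) := vs; apply: filterS => t st.
  have [k _ Fkt] : (\bigcup_k F k) t by rewrite -FT.
  have At : A t.
    apply: lt_le_trans (st k.+1); rewrite sS indicE mem_set// mulr1.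
    rewrite ltr_wpDl// /s sumr_ge0// => i _.
    by rewrite mulr_ge0// ltW.
  by rewrite !indicE mem_set// memNset ?mul1r ?addr0//; exact.
move=> t; rewrite !indicE; have [At|nAt] := pselect (A t).
  by rewrite mem_set// memNset ?mul1r ?addr0//; exact.
by rewrite memNset// mem_set// mul0r add0r.
Qed.

End KoetheFunctionals.

(** * Majorants of functionals and their representing measures *)

Import HBSimple HBNNSimple.

Section Representation.
Context d (S : measurableType d) (R : realType).
Variable mu : {measure set S -> \bar R}.
Variable E : koethe mu.
Implicit Types (x y w : S -> R) (A : set S) (L : (S -> R^o) -> R).

Let p := koethe_seminormed E.

Definition positive L : Prop :=
  forall x, kset E x -> (forall t, 0 <= x t) -> 0 <= L x.

(** Apply the sandwich theorem to the norm of the positive part and the cone of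
    all pairs [(x, F h)] with [`|h| <= x]: being below the norm of the positive
    part makes the functional both contractive and positive. *)
Lemma positive_majorant (muc : measure_is_complete mu)
    (X : completeNormedModType R) (F : (S -> X) -> R) :
    contractive (bochner_seminormed X muc E) F ->
  exists L, [/\ contractive p L, positive L &
    forall h, bochner_set E h -> F h <= L (fun t => `|h t|)].
Proof.
move=> [Flin F1].
pose pos (x : S -> R) t := Num.max 0 (x t).
have Epos x : kset E x -> kset E (pos x) by move=> Ex; have [] := kset_pos Ex.
pose q (x : selt p) : R := knorm E (pos (selt_val x)).
have selE (x : selt p) : kset E (selt_val x) by exact: seltP.
have pos0 x t : 0 <= pos x t by rewrite le_max lexx.
have sq : sublinear q.
  split=> [x y|a x a0].
    apply: le_trans (knormD (Epos _ (selE x)) (Epos _ (selE y))).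
    apply: knorm_le; [|exact: Epos (selE (x + y))|move=> t].
      by apply: ksetD; exact: Epos.
    rewrite !ger0_norm ?addr_ge0//.
    rewrite ge_max addr_ge0//= lerD//; by rewrite le_max lexx orbT.
  rewrite /q -[a in RHS]ger0_norm// -(knormZ _ (Epos _ (selE x))).
  congr knorm; apply/funext => t.
  by rewrite /pos maxr_pMr// mulr0.
pose G (x : selt p) (r : R) := exists h, [/\ bochner_set E h,
  forall t, `|h t| <= selt_val x t & r = F h].
have [|x r|f [fq fG]] := @sandwich R (selt p) q G sq.
- split.
  + exists 0; split; first exact: bochner_set0.
      by move=> t; rewrite normr0.
    have := F1 0 (bochner_set0 X E); rewrite snorm0 normr_le0.
    by move=> /eqP.
  + move=> x _ y _ [h [Bh hx ->]] [k [Bk ky ->]].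
    exists (1 *: h + k); split; first exact: bochner_setP.
      move=> t; rewrite scale1r (le_trans (ler_normD _ _))//.
      by rewrite lerD.
    by rewrite Flin// mul1r.
  + move=> a x _ a0 [h [Bh hx ->]]; exists (a *: h + 0); split.
    * exact: bochner_setP (bochner_set0 X E).
    * move=> t; rewrite addr0 normrZ ger0_norm//.
      by apply: ler_wpM2l.
    * rewrite Flin//; last exact: bochner_set0.
      have := F1 0 (bochner_set0 X E); rewrite snorm0 normr_le0.
      by move=> /eqP ->; rewrite addr0.
- move=> [h [Bh hx ->]]; apply: le_trans (ler_norm _) _.
  apply: le_trans (F1 h Bh) _; apply: knorm_le; [exact: Epos|exact: Bh.2|].
  move=> t; rewrite normr_id ger0_norm//.
  by rewrite (le_trans (hx t))// le_max lexx orbT.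
have [L LE] := selt_extension (f : selt p -> R).
have cL : contractive p L.
  split=> [a x y Ex Ey|x Ex].
    pose x' := SElt (mem_set Ex : x \in sdom_pred p).
    pose y' := SElt (mem_set Ey : y \in sdom_pred p).
    by rewrite (LE (a *: x' + y')) (LE x') (LE y') linearP.
  pose x' := SElt (mem_set Ex : x \in sdom_pred p).
  have fx (y : selt p) : f y <= knorm E (selt_val y).
    by apply: le_trans (fq y) _; have [] := kset_pos (selE y).
  rewrite (LE x') ler_norml fx andbT lerNl.
  have -> : - f x' = f (- x') by rewrite linearN.
  by apply: le_trans (fx _) _; rewrite -[leRHS](snormN Ex); exact: lexx.
exists L; split=> // [x Ex x0|h Bh].
  pose x' := SElt (mem_set Ex : x \in sdom_pred p).
  rewrite (LE x') -oppr_le0.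
  have -> : - f x' = f (- x') by rewrite linearN.
  apply: le_trans (fq _) _; rewrite /q (_ : pos _ = fun=> 0) ?knorm0//.
  apply/funext => t; apply/max_idPl; rewrite /= oppr_le0; exact: x0.
pose x' := SElt (mem_set Bh.2 : (fun t => `|h t|) \in sdom_pred p).
by rewrite (LE x'); apply: fG; exists h; split.
Qed.

Lemma indicU_disjoint A B x : A `&` B = set0 ->
  (fun t => \1_(A `|` B) t * x t) = (fun t => \1_A t * x t + \1_B t * x t).
Proof.
move=> AB; apply/funext => t; rewrite -mulrDl !indicE in_setU.
have [At|_] := boolP (t \in A); have [Bt|_] := boolP (t \in B);
  rewrite ?addr0 ?add0r//.
have : (A `&` B) t by split; exact: set_mem.
by rewrite AB.
Qed.

(** [m] is the measure with density [phi * w] with respect to [mu], where [phi]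
    in the Köthe dual is the function representing [L]. *)
Definition represents (m : {finite_measure set S -> \bar R}) w L : Prop :=
  forall x, kset E x -> (forall t, 0 <= x t) ->
    m.-integrable setT (EFin \o (fun t => x t / w t)) /\
    \int[m]_t (x t / w t) = L x.

(** [m A] is [L (\1_A * w)]. The formula holds by linearity when [x / w] is a
    simple function, and order continuity of the norm matches monotone
    convergence of the integrals when simple functions increase to [x / w]. *)
Lemma integral_representation w L : koethe_order_continuous E ->
    kset E w -> (forall t, 0 < w t) -> contractive p L -> positive L ->
  exists m : {finite_measure set S -> \bar R}, represents m w L.
Proof.
move=> ocE Ew w0 cL pL; have w0' t := ltW (w0 t).
pose T A := L (fun t => \1_A t * w t).
have E1 A : measurable A -> kset E (fun t => \1_A t * w t).
  by move=> mA; have [] := kset_restrict mA Ew.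
have T0 : T set0 = 0.
  rewrite -(contractive0 cL); congr L.
  by apply/funext => t; rewrite indic0 mul0r.
have Tge0 A : measurable A -> 0 <= T A.
  by move=> mA; apply: pL; [exact: E1|move=> t; rewrite mulr_ge0].
have TT : countably_additive T.
  apply: (sigma_additive_dominated ocE Ew w0').
    move=> A B mA mB AB; rewrite /T indicU_disjoint//.
    exact: (contractiveD cL (E1 A mA) (E1 B mB)).
  by move=> A mA; apply: cL.2; exact: E1.
have [m mE] := finite_measure_of T0 Tge0 TT.
exists m => x Ex x0.
pose y t := x t / w t.
have y0 t : 0 <= y t by rewrite divr_ge0.
have yw t : y t * w t = x t by rewrite divfK// gt_eqF.
have my : measurable_fun setT y.
  apply: measurable_funM; first exact: kmeasurable Ex.
  rewrite (_ : (fun t => (w t)^-1) = (fun t => w t `^ -1)).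
    by apply: measurableT_comp (measurable_powR _) _; exact: kmeasurable Ew.
  by apply/funext => t; rewrite powR_inv1.
have myE : measurable_fun setT (EFin \o y) by exact/measurable_EFinP.
pose g := nnsfun_approx measurableT myE.
have gcvgE t : (fun n => (g n t)%:E) @ \oo --> (y t)%:E.
  by apply: (cvg_nnsfun_approx measurableT myE) => // s _; rewrite lee_fin.
have gcvg t : (fun n => g n t) @ \oo --> y t.
  exact: (fine_cvg (gcvgE t)).
have gmono t : {homo (fun n => g n t) : m n / (m <= n)%N >-> m <= n}.
  by move=> i j ij; have /lefP := nd_nnsfun_approx measurableT myE ij; apply.
have gle n t : g n t <= y t.
  rewrite -(cvg_lim (@Rhausdorff R) (gcvg t)).
  apply: nondecreasing_cvgn_le; first exact: gmono.
  by apply/cvg_ex; exists (y t).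
have Eg n : kset E (fun t => g n t * w t).
  apply: (kset_le Ex _ _).1.
    apply: measurable_funM; last exact: kmeasurable Ew.
    exact: measurable_funPT.
  move=> t; rewrite ger0_norm ?mulr_ge0// ger0_norm// -[leRHS]yw.
  by rewrite ler_wpM2r.
have Lg n : (\int[m]_t (g n t)%:E = (L (fun t => g n t * w t))%:E)%E.
  rewrite integralT_nnsfun sintegralE (fsbig_finite _ _ (fimfunP (g n))) /=.
  have mpre r : measurable (g n @^-1` [set r]) by exact: measurable_sfunP.
  pose rs : seq R := finmap.enum_fset (fset_set (range (g n))).
  rewrite (_ : (fun t => g n t * w t) = (fun t =>
      \sum_(r <- rs) r * (\1_(g n @^-1` [set r]) t * w t))).
    have [_ ->] := contractive_sum rs id cL (fun r => E1 _ (mpre r)).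
    rewrite -sumEFin; apply: eq_bigr => r _.
    by rewrite mE.
  apply/funext => t; rewrite fimfunE (fsbig_finite _ _ (fimfunP (g n))) /=.
  by rewrite mulr_suml; apply: eq_bigr => r _; rewrite mulrA.
have Lcvg : (fun n => L (fun t => g n t * w t)) @ \oo --> L x.
  have knorm_cvg : (fun n => knorm E (fun t => x t - g n t * w t)) @ \oo --> (0 : R).
    apply: (order_continuous_seq ocE).
    - by move=> n; exact: ksetB.
    - by move=> n t; rewrite subr_ge0 -[leRHS]yw ler_wpM2r.
    - by move=> t i j ij; rewrite lerD2l lerN2 ler_wpM2r// gmono.
    - move=> t; rewrite -(subrr (x t)); apply: cvgB; first exact: cvg_cst.
      by rewrite -[X in _ --> X]yw; apply: cvgMl; exact: gcvg.
  apply: (fun H => @cvg_dominated _ _ _ _ H knorm_cvg) => n.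
  rewrite distrC -(contractiveB cL Ex (Eg n)).
  by apply: cL.2; exact: ksetB Ex (Eg n).
have intE : (\int[m]_t (y t)%:E = (L x)%:E)%E.
  have mono := @cvg_monotone_convergence _ _ _ m _ measurableT
    (fun n t => (g n t)%:E).
  have limE : (\int[m]_t (fun t => limn (fun n => (g n t)%:E)) t =
      \int[m]_t (y t)%:E)%E.
    by apply: eq_integral => t _; apply: cvg_lim.
  rewrite limE in mono.
  have h1 : ((fun n => \int[m]_t (g n t)%:E) @ \oo --> \int[m]_t (y t)%:E)%E.
    apply: mono.
    - by move=> n; apply/measurable_EFinP; exact: measurable_funPT.
    - by move=> n t _; rewrite lee_fin.
    - by move=> t _ i j ij; rewrite lee_fin gmono.
  have h2 : ((fun n => \int[m]_t (g n t)%:E) @ \oo --> (L x)%:E)%E.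
    under eq_fun do rewrite Lg.
    by apply: cvg_EFin; [exact: nearW|exact: Lcvg].
  exact: (cvg_unique (@ereal_hausdorff R) h1 h2).
split; last by rewrite /Rintegral intE.
apply/integrableP; split; first exact: myE.
have -> : (\int[m]_t `|(EFin \o y) t| = \int[m]_t (y t)%:E)%E.
  by apply: eq_integral => t _; rewrite gee0_abs// lee_fin.
by rewrite intE ltry.
Qed.

End Representation.

(** * Where the norms of the sequence vanish *)

Section Vanishing.
Context d (S : measurableType d) (R : realType).
Variable mu : {measure set S -> \bar R}.
Variable E : koethe mu.
Implicit Types (x y w : S -> R) (A : set S) (L : (S -> R^o) -> R).

Let p := koethe_seminormed E.

Lemma contractive_restrict A L : measurable A -> contractive p L ->
  contractive p (fun x => L (fun t => \1_A t * x t)).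
Proof.
move=> mA [Llin L1]; split=> [a x y Ex Ey|x Ex].
  have [EAx _] := kset_restrict mA Ex.
  have [EAy _] := kset_restrict mA Ey.
  rewrite -(Llin a _ _ EAx EAy); congr L; apply/funext => t.
  by rewrite !fctE /= mulrDr; congr (_ + _); exact: mulrCA.
have [EAx nAx] := kset_restrict mA Ex.
exact: le_trans (L1 _ EAx) nAx.
Qed.

(** Let [A] be a set on which [x > 0], the [u n] tend to 0 and stay below [w].
    By dominated convergence [L (\1_A * u n) --> 0], so the functional
    [L (\1_(~` A) * _)] still tends to 1 along [u]. Now luacs+ for this
    functional gives [L (\1_(~` A) * x) = 1 = L x], hence [x = 0] almost
    everywhere on [A], and [A] is null. *)
Lemma vanishing_null (m : {finite_measure set S -> \bar R}) w L
    (x : S -> R) (u : nat -> S -> R) :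
    luacs_plus (kspace E) -> kset E w -> (forall t, 0 < w t) ->
    contractive p L -> represents E m w L ->
    kset E x -> (forall t, 0 <= x t) -> knorm E x = 1 ->
    (forall n, kset E (u n)) -> (forall n t, 0 <= u n t) ->
    (forall n, knorm E (u n) <= 1) ->
    (fun n => knorm E (fun t => u n t + x t)) @ \oo --> (2 : R) ->
    (fun n => L (u n)) @ \oo --> (1 : R) ->
  \forall t \ae m, u^~ t @ \oo --> (0 : R) -> x t = 0.
Proof.
move=> lE Ew w0 cL rL Ex x0 x1 Eu u0 u1 ux Lu.
have Lx : L x = 1 by apply/(luacs_plus_raw lE Ex x1 Eu u1 ux cL).
pose A N := [set t | 0 < x t] `&` [set t | u^~ t @ \oo --> (0 : R)] `&`
  \bigcap_(n in [set n | (N <= n)%N]) ~` [set t | 0 < u n t - w t].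
have mA N : measurable (A N).
  apply: measurableI; first apply: measurableI.
  - by apply: measurable_gt; exact: kmeasurable Ex.
  - by apply: measurable_cvg0 => // n; exact: kmeasurable (Eu n).
  - apply: bigcap_measurableType => n _; apply: measurableC.
    by apply: measurable_gt; apply: measurable_funB; [exact: kmeasurable (Eu n)|exact: kmeasurable Ew].
have Anull N : \forall t \ae m, ~ A N t.
  pose v n t := \1_(A N) t * u (n + N)%N t.
  have Ev n : kset E (v n) by have [] := kset_restrict (mA N) (Eu (n + N)%N).
  have v0 n t : 0 <= v n t by rewrite mulr_ge0.
  have Lv : (fun n => L (v n)) @ \oo --> (0 : R).
    have LvE n : \int[m]_t (v n t / w t) = L (v n) by exact: (rL _ (Ev n) (v0 n)).2.
    under eq_fun do rewrite -LvE.
    apply: fine_cvg.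
    have mv n : measurable_fun setT (EFin \o (fun t => v n t / w t)).
      exact: measurable_int (rL _ (Ev n) (v0 n)).1.
    have one : m.-integrable setT (cst 1%E : S -> \bar R).
      exact: finite_measure_integrable_cst.
    have [] := @dominated_convergence _ _ _ m setT measurableT
      (fun n t => (v n t / w t)%:E) (cst 0%E) (cst 1%E) mv _ _ one _.
    - exact: measurable_cst.
    - apply: aeW => t _; apply: cvg_EFin; first exact: nearW.
      rewrite -[X in _ --> X](mul0r (w t)^-1); apply: cvgMl.
      rewrite /v indicE; have [/set_mem[[_ /= ut] _]|_] := boolP (t \in A N).
        under eq_fun do rewrite mul1r.
        by have := ut; rewrite -(cvg_shiftn N).
      by under eq_fun do rewrite mul0r; exact: cvg_cst.
    - apply: aeW => t n _; rewrite lee_fin ger0_norm ?divr_ge0 ?(ltW (w0 t))//.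
      rewrite ler_pdivrMr// mul1r /v indicE.
      have [/set_mem[_ At]|_] := boolP (t \in A N); last by rewrite mul0r ltW.
      have /negP := At (n + N)%N (leq_addl n N).
      by rewrite mul1r -leNgt subr_le0.
    - by move=> _; rewrite integral0.
  have L'v : (fun n => L (fun t => \1_(~` A N) t * u (n + N)%N t)) @ \oo --> (1 : R).
    rewrite (_ : (fun n => _) = fun n => L (u (n + N)%N) - L (v n)).
      rewrite -[X in _ --> X]subr0; apply: cvgB Lv.
      by have := Lu; rewrite -(cvg_shiftn N).
    apply/funext => n; rewrite -(contractiveB cL (Eu _) (Ev n)).
    congr L; apply/funext => t; rewrite /v !indicE in_setC.
    by case: (t \in A N) => /=; rewrite ?mul0r ?mul1r ?subrr ?subr0.
  have ux' : (fun n => knorm E (fun t => u (n + N)%N t + x t)) @ \oo --> (2 : R).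
    by have := ux; rewrite -(cvg_shiftn N).
  have cL' := contractive_restrict (measurableC (mA N)) cL.
  have L'x : L (fun t => \1_(~` A N) t * x t) = 1.
    apply/(luacs_plus_raw lE Ex x1 (fun n => Eu (n + N)%N)
      (fun n => u1 (n + N)%N) ux' cL').
    exact: L'v.
  have [EAx _] := kset_restrict (mA N) Ex.
  have [ECx _] := kset_restrict (measurableC (mA N)) Ex.
  have LAx : L (fun t => \1_(A N) t * x t) = 0.
    have := contractiveD cL EAx ECx; rewrite L'x.
    rewrite -indicU_disjoint ?setICr// setUCr.
    rewrite (_ : (fun t => \1_setT t * x t) = x) ?Lx; first lra.
    by apply/funext => t; rewrite indicT mul1r.
  have Ax0 t : 0 <= \1_(A N) t * x t by rewrite mulr_ge0.
  have [iAx] := rL _ EAx Ax0; rewrite LAx => int0.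
  have abs0 : (\int[m]_t `|(EFin \o (fun t => \1_(A N) t * x t / w t)%R) t| = 0)%E.
    pose z t := \1_(A N) t * x t / w t.
    have -> : (\int[m]_t `|(EFin \o z) t| = \int[m]_t (z t)%:E)%E.
      apply: eq_integral => t _; rewrite gee0_abs// lee_fin.
      by rewrite divr_ge0// ltW.
    rewrite -[LHS]fineK; first by congr EFin; exact: int0.
    exact: (integrable_fin_num measurableT iAx).
  have := (ae_eq_integral_abs m measurableT (measurable_int _ iAx)).1 abs0.
  apply: filterS => t /(_ I)[] /eqP + At.
  rewrite indicE mem_set// mul1r mulf_eq0 invr_eq0 (gt_eqF (w0 t)) orbF.
  by case: At => [[/= /gt_eqF ->]].
have /(@ae_foralln _ _ _ m) := Anull; apply: filterS => t At ut.
apply/eqP; case: eqVneq => // xt.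
have /cvgr0Pnorm_lt/(_ (w t) (w0 t))[N _ hN] := ut.
case: (At N); split; first by split => //=; rewrite lt_neqAle eq_sym xt x0.
move=> n /= Nn; apply/negP; rewrite -leNgt subr_le0; apply/ltW.
by have := hN n Nn; rewrite ger0_norm.
Qed.

End Vanishing.

(** * Densities of functionals on the Köthe-Bochner space *)

Section Densities.
Context d (S : measurableType d) (R : realType).
Variable mu : {measure set S -> \bar R}.
Hypothesis muc : measure_is_complete mu.
Variables (E : koethe mu) (X : completeNormedModType R).
Implicit Types (A : set S) (f : S -> X) (F : (S -> X) -> R).

Definition restrict_fun A f : S -> X := fun t => (\1_A t : R) *: f t.

Lemma norm_restrict_fun A f t : `|restrict_fun A f t| = \1_A t * `|f t|.
Proof. by rewrite normrZ ger0_norm. Qed.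

Lemma simple_function_restrict A (s : S -> X) : measurable A ->
  simple_function s -> simple_function (restrict_fun A s).
Proof.
move=> mA ss; split.
  apply: (@sub_finite_set _ _ (range s `|` [set 0])).
    move=> _ [t _ <-]; rewrite /restrict_fun indicE.
    case: (t \in A); [left|right]; rewrite ?scale1r ?scale0r//.
  by rewrite finite_setU; split; [case: ss|exact: finite_set1].
move=> z; rewrite (_ : _ @^-1` _ = (A `&` s @^-1` [set z]) `|`
    (~` A `&` [set _ | 0 = z])).
  apply: measurableU; apply: measurableI => //.
  - exact: ss.2.
  - exact: measurableC.
  - have [z0|z0] := pselect (0 = z).
      by have -> : [set _ : S | 0 = z] = setT by apply/seteqP; split.
    by have -> : [set _ : S | 0 = z] = set0 by apply/seteqP; split.
apply/seteqP; split=> t /=; rewrite /restrict_fun indicE.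
  have [At|At] := boolP (t \in A); rewrite ?scale1r ?scale0r => h.
    by left; split => //; exact: set_mem.
  by right; split => // At'; rewrite mem_set in At.
move=> [[At st]|[At st]]; first by rewrite mem_set// scale1r.
by rewrite memNset// scale0r.
Qed.

Lemma bochner_set_restrict A f : measurable A -> bochner_set E f ->
  bochner_set E (restrict_fun A f).
Proof.
move=> mA [[s [ss sf]] Ef]; split.
  exists (fun n => restrict_fun A (s n)); split.
    by move=> n; exact: simple_function_restrict.
  by apply: filterS sf => t sf; exact: cvgZr.
have [+ _] := kset_restrict mA Ef; congr kset.
by apply/funext => t; rewrite norm_restrict_fun.
Qed.

Variables (F : (S -> X) -> R) (L : (S -> R^o) -> R) (w : S -> R).
Variable m : {finite_measure set S -> \bar R}.
Hypothesis ocE : koethe_order_continuous E.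
Hypothesis cF : contractive (bochner_seminormed X muc E) F.
Hypothesis FL : forall h, bochner_set E h -> F h <= L (fun t => `|h t|).
Hypothesis rL : represents E m w L.

(** The real numbers [g t] play the role of the values at [f t] of a
    functional on [X] depending on [t]. *)
Definition density f (g : S -> R) : Prop :=
  m.-integrable setT (EFin \o g) /\
  forall A, measurable A -> F (restrict_fun A f) = \int[m]_(t in A) g t.

Lemma functional0 : F 0 = 0.
Proof.
have := cF.2 0 (bochner_set0 X E); rewrite (snorm0 (bochner_seminormed X muc E)).
by rewrite normr_le0 => /eqP.
Qed.

Lemma norm_le_majorant h : bochner_set E h -> `|F h| <= L (fun t => `|h t|).
Proof.
move=> Bh; rewrite ler_norml FL// andbT lerNl.
have -> : - F h = F (-1 *: h + 0).
  by rewrite cF.1//; [rewrite mulN1r functional0 addr0|exact: bochner_set0].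
have := FL (bochner_setP muc (-1) Bh (bochner_set0 X E)).
by congr (_ <= L _); apply/funext => t; rewrite scaleN1r addr0 normrN.
Qed.

Lemma majorant_restrict A f : measurable A -> bochner_set E f ->
  L (fun t => `|restrict_fun A f t|) = \int[m]_(t in A) (`|f t| / w t).
Proof.
move=> mA Bf; have BAf := bochner_set_restrict mA Bf.
have [_ <-] := rL BAf.2 (fun t => normr_ge0 _).
rewrite [RHS]Rintegral_mkcond; apply: eq_Rintegral => t _.
rewrite norm_restrict_fun patchE indicE.
by case: (t \in A); rewrite ?mul1r ?mul0r.
Qed.

(** Order continuity makes [A |-> F (\1_A f)] countably additive, and the
    majorant [L] makes it absolutely continuous with respect to [m]. *)
Lemma density_exists f : bochner_set E f -> exists g, density f g.
Proof.
move=> Bf; have Bf' A : measurable A -> bochner_set E (restrict_fun A f).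
  by move=> mA; exact: bochner_set_restrict.
have k1 : measurable_fun setT (fun t => `|f t| / w t).
  by apply/measurable_EFinP; exact: measurable_int (rL Bf.2 (fun t => normr_ge0 _)).1.
apply: (@density_of_dominated _ _ _ m (fun A => F (restrict_fun A f)) _ _ _ k1).
- rewrite -functional0; congr F; apply/funext => t.
  by rewrite /restrict_fun indic0 scale0r.
- apply: (sigma_additive_dominated ocE Bf.2) => //.
  + move=> A B mA mB AB.
    have := cF.1 1 _ _ (Bf' A mA) (Bf' B mB); rewrite mul1r => <-.
    congr F; apply/funext => t.
    have := congr1 (fun u => u t) (@indicU_disjoint _ _ R A B (fun=> 1) AB).
    by rewrite /= !mulr1 /restrict_fun !fctE scale1r -scalerDl => ->.
  + move=> A mA; apply: le_trans (cF.2 _ (Bf' A mA)) _.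
    apply: knorm_le; [exact: (kset_restrict mA Bf.2).1|exact: (Bf' A mA).2|].
    by move=> t; rewrite norm_restrict_fun.
- move=> A mA; rewrite -majorant_restrict//; exact: norm_le_majorant (Bf' A mA).
Qed.

Lemma density_lin (a : R) f g f' g' : bochner_set E f -> bochner_set E f' ->
  density f g -> density f' g' ->
  density (a *: f + f') (fun t => a * g t + g' t).
Proof.
move=> Bf Bf' [Ig Fg] [Ig' Fg'].
have Iag : m.-integrable setT (EFin \o (fun t => a * g t)).
  exact: (integrableZl measurableT a Ig).
split; first exact: (integrableD measurableT Iag Ig').
move=> A mA.
have sub h : m.-integrable setT (EFin \o h) -> m.-integrable A (EFin \o h).
  exact: integrableS.
rewrite RintegralD//; [|exact: sub..]; rewrite RintegralZl//; last exact: sub.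
rewrite -Fg// -Fg'// -cF.1; [|exact: bochner_set_restrict..].
congr F; apply/funext => t.
by rewrite /restrict_fun !fctE scalerDr !scalerA mulrC.
Qed.

Lemma density_le f g : bochner_set E f -> density f g ->
  \forall t \ae m, g t <= `|f t| / w t.
Proof.
move=> Bf [Ig Fg].
apply: ae_le_of_integrals => //.
  exact: (rL Bf.2 (fun t => normr_ge0 _)).1.
move=> A mA; rewrite -Fg// -majorant_restrict//.
by apply: FL; exact: bochner_set_restrict.
Qed.

Lemma density_sum (z : nat -> S -> X) (g : nat -> S -> R) (c : nat -> R) N :
    (forall i, bochner_set E (z i)) -> (forall i, density (z i) (g i)) ->
  bochner_set E (fun t => \sum_(i < N) c i *: z i t) /\
  density (fun t => \sum_(i < N) c i *: z i t)
    (fun t => \sum_(i < N) c i * g i t).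
Proof.
move=> Bz zg; elim: N => [|N [IH1 IH2]].
  under eq_fun do rewrite big_ord0; under [X in density _ X]eq_fun do rewrite big_ord0.
  have B0 := bochner_set0 X E.
  split=> //; split; first exact: integrable0.
  move=> A mA; rewrite Rintegral_cst// mul0r -functional0; congr F.
  by apply/funext => t; rewrite /restrict_fun scaler0.
have zE : (fun t => \sum_(i < N.+1) c i *: z i t) =
    c N *: z N + (fun t => \sum_(i < N) c i *: z i t).
  by apply/funext => t; rewrite !fctE big_ord_recr addrC.
have gE : (fun t => \sum_(i < N.+1) c i * g i t) =
    (fun t => c N * g N t + \sum_(i < N) c i * g i t).
  by apply/funext => t; rewrite big_ord_recr addrC.
by rewrite zE gE; split; [exact: bochner_setP|exact: density_lin].
Qed.

(** There are countably many rational combinations, so the exceptional sets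
    can be collected in a single null set. *)
Lemma density_combinations (z : nat -> S -> X) (g : nat -> S -> R) :
    (forall i, bochner_set E (z i)) -> (forall i, density (z i) (g i)) ->
  \forall t \ae m, forall s : seq rat,
    \sum_(i < size s) ratr s`_i * g i t <=
      (w t)^-1 * `|\sum_(i < size s) (ratr s`_i : R) *: z i t|.
Proof.
(* An enumeration of the finite sequences of rationals. *)
move=> Bz zg; pose sq k := odflt [::] (unpickle k : option (seq rat)).
have : forall k, \forall t \ae m,
    \sum_(i < size (sq k)) ratr (sq k)`_i * g i t <=
      (w t)^-1 * `|\sum_(i < size (sq k)) (ratr (sq k)`_i : R) *: z i t|.
  move=> k; have [B D] := density_sum (fun i => ratr (sq k)`_i) (size (sq k)) Bz zg.
  by apply: filterS (density_le B D) => t; rewrite mulrC.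
move=> /(@ae_foralln _ _ _ m); apply: filterS => t ht s.
by have := ht (pickle s); rewrite /sq pickleK.
Qed.

End Densities.

(** * The Köthe-Bochner space *)

Section KoetheBochner.
Context d (S : measurableType d) (R : realType).
Variable mu : {sigma_finite_measure set S -> \bar R}.
Hypothesis muc : measure_is_complete mu.
Variables (E : koethe mu) (X : completeNormedModType R).

(** The whole argument for representatives instead of classes. *)
Lemma bochner_luacs (F : (S -> X) -> R) (f : S -> X) (u : nat -> S -> X) :
    koethe_order_continuous E -> luacs X -> luacs_plus (kspace E) ->
    contractive (bochner_seminormed X muc E) F ->
    bochner_set E f -> bochner_norm E f = 1 ->
    (forall n, bochner_set E (u n)) -> (forall n, bochner_norm E (u n) = 1) ->
    (fun n => bochner_norm E (u n + f)) @ \oo --> (2 : R) ->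
    (fun n => F (u n)) @ \oo --> (1 : R) ->
  F f = 1.
Proof.
move=> ocE lX lE cF Bf f1 Bu u1 uf Fu.
have [L [cL pL FL]] := positive_majorant cF.
have [w Ew w0] := weak_unit E (sigma_finiteT mu).
have [m rL] := integral_representation ocE Ew w0 cL pL.
pose xf t := `|f t|; pose xu n t := `|u n t|; pose h n t := `|(u n + f) t|.
pose y n t := Num.max 0 (h n t - xf t).
have Exf : kset E xf by exact: Bf.2.
have Exu n : kset E (xu n) by exact: (Bu n).2.
have Buf n : bochner_set E (u n + f).
  by have := bochner_setP muc 1 (Bu n) Bf; rewrite scale1r.
have Eh n : kset E (h n) by exact: (Buf n).2.
have Ey n : kset E (y n) by have [] := kset_pos (ksetB (Eh n) Exf).
have xf0 t : 0 <= xf t by exact: normr_ge0.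
have xu0 n t : 0 <= xu n t by exact: normr_ge0.
have y0 n t : 0 <= y n t by rewrite le_max lexx.
have yx n t : y n t <= xu n t.
  by rewrite ge_max xu0 lerBlDr; exact: ler_normD.
have hy n t : h n t <= y n t + xf t.
  by rewrite -lerBlDr le_max lexx orbT.
have ynorm n : knorm E (y n) <= 1.
  rewrite -[leRHS](u1 n); apply: (knorm_le (Exu n) (Ey n)) => t.
  by rewrite !ger0_norm.
(* Applied to xu and to y. *)
have sum_cvg (v : nat -> S -> R) : (forall n, kset E (v n)) ->
    (forall n t, 0 <= v n t) ->
    (forall n, knorm E (v n) <= 1) -> (forall n t, h n t <= v n t + xf t) ->
    (fun n => knorm E (fun t => v n t + xf t)) @ \oo --> (2 : R).
  move=> Ev v0 v1 hv.
  apply: (@squeeze_cvgr _ _ _ _ (fun n => knorm E (h n)) (fun=> 2)); last exact: cvg_cst.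
    apply: nearW => n; apply/andP; split.
      apply: knorm_le => //; first exact: ksetD.
      by move=> t; rewrite ger0_norm ?normr_ge0// ger0_norm// addr_ge0.
    apply: le_trans (knormD (Ev n) Exf) _.
    by have := v1 n; have : knorm E xf = 1 := f1; lra.
  exact: uf.
have hx n t : h n t <= xu n t + xf t by exact: ler_normD.
have xu1 n : knorm E (xu n) <= 1 by rewrite [knorm _ _]u1.
have xcvg := sum_cvg xu Exu xu0 xu1 hx.
have ycvg := sum_cvg y Ey y0 ynorm hy.
have Lxu : (fun n => L (xu n)) @ \oo --> (1 : R).
  apply: (@squeeze_cvgr _ _ _ _ (fun n => F (u n)) (fun=> 1)) => //; last exact: cvg_cst.
  by apply: nearW => n; rewrite (FL _ (Bu n)) /= (le_trans (contractive_le cL (Exu n))).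
have Lxf : L xf = 1.
  by apply/(luacs_plus_raw lE Exf f1 Exu xu1 xcvg cL).
have Ly : (fun n => L (y n)) @ \oo --> (1 : R).
  by apply/(luacs_plus_raw lE Exf f1 Ey ynorm ycvg cL).
have [g0 D0] := density_exists ocE cF FL rL Bf.
have [g D] := choice (fun n => density_exists ocE cF FL rL (Bu n)).
(* a and |b| are the defects at the point t; the integrals of their sum q
   tend to 0. *)
pose a n t := (xu n t - y n t) / w t.
pose b n t := xu n t / w t - g n t.
pose q n t := a n t + `|b n t|.
have Exy n : kset E (fun t => xu n t - y n t) by exact: ksetB.
have xy0 n t : 0 <= xu n t - y n t by rewrite subr_ge0.
have [Ia La] : (forall n, m.-integrable setT (EFin \o a n)) /\
    forall n, \int[m]_t a n t = L (xu n) - L (y n).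
  split=> n; have [Ian aE] := rL _ (Exy n) (xy0 n); first exact: Ian.
  by rewrite [LHS]aE; exact: contractiveB cL (Exu n) (Ey n).
have Ixw n := (rL _ (Exu n) (xu0 n)).1.
have Ib n : m.-integrable setT (EFin \o b n).
  exact: (integrableB measurableT (Ixw n) (D n).1).
have Fdens k G : density F m k G -> F k = \int[m]_t G t.
  move=> [_ /(_ setT measurableT) <-]; congr F.
  by apply/funext => t; rewrite /restrict_fun indicT scale1r.
have Lb n : \int[m]_t b n t = L (xu n) - F (u n).
  rewrite (RintegralB measurableT (Ixw n) (D n).1) (Fdens _ _ (D n)).
  by rewrite (rL _ (Exu n) (xu0 n)).2.
have b0 n : \forall t \ae m, 0 <= b n t.
  have := density_le FL rL (Bu n) (D n).
  by apply: filterS => t; rewrite /b subr_ge0.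
have EFin_int (k : S -> R) : m.-integrable setT (EFin \o k) ->
    (\int[m]_t (k t)%:E = (\int[m]_t k t)%R%:E)%E.
  by move=> Ik; rewrite /Rintegral fineK//; exact: integrable_fin_num.
have intq n : (\int[m]_t (q n t)%:E =
    ((L (xu n) - L (y n)) + (L (xu n) - F (u n)))%R%:E)%E.
  have mb : measurable_fun setT (EFin \o b n) by exact: measurable_int (Ib n).
  have mb' : measurable_fun setT (fun t => `|b n t|).
    by apply: measurableT_comp => //; apply/measurable_EFinP.
  rewrite EFinD -La -Lb -!EFin_int//.
  under eq_integral => t _ do rewrite EFinD.
  rewrite ge0_integralD//=; first last.
  - exact/measurable_EFinP.
  - exact: measurable_int (Ia n).
  - by move=> t _; rewrite lee_fin divr_ge0// ltW.
  congr (_ + _)%E; apply: ae_eq_integral => //.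
  - exact/measurable_EFinP.
  - by apply: filterS (b0 n) => t bt _ /=; rewrite ger0_norm.
have q0 n t : 0 <= q n t by rewrite addr_ge0// divr_ge0// ltW.
have mq n : measurable_fun setT (q n).
  apply: measurable_funD.
    by apply/measurable_EFinP; exact: measurable_int (Ia n).
  apply: measurableT_comp => //.
  by apply/measurable_EFinP; exact: measurable_int (Ib n).
have qcvg : (fun n => (L (xu n) - L (y n)) + (L (xu n) - F (u n))) @ \oo --> (0 : R).
  rewrite (_ : 0 = (1 - 1) + (1 - 1) :> R); last by rewrite subrr addr0.
  by apply: cvgD; apply: cvgB.
have [|s [sn sq]] := L1_subsequence (m := m) mq q0.
  move=> e e0; have /cvgr0Pnorm_lt/(_ e e0)[N _ hN] := qcvg.
  exists N => n Nn; rewrite intq lte_fin.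
  exact: le_lt_trans (ler_norm _) (hN n Nn).
have van := @vanishing_null _ _ _ _ _ m w L xf (fun n => xu (s n)) lE Ew w0 cL rL
  Exf xf0 f1 (fun n => Exu (s n)) (fun n => xu0 (s n)) (fun n => xu1 (s n))
  (cvg_subsequence sn xcvg) (cvg_subsequence sn Lxu).
pose z i := if i is n.+1 then u (s n) else f.
pose gz i := if i is n.+1 then g (s n) else g0.
have Bz i : bochner_set E (z i) by case: i => [|i]; [exact: Bf|exact: Bu].
have Dz i : density F m (z i) (gz i) by case: i => [|i]; [exact: D0|exact: D].
have comb := density_combinations cF FL rL Bz Dz.
rewrite (Fdens _ _ D0) -Lxf -(rL _ Exf xf0).2 /Rintegral; congr fine.
apply: ae_eq_integral => //.
- exact: measurable_int D0.1.
- exact: measurable_int (rL _ Exf xf0).1.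
have : \forall t \ae m, [/\ (forall s : seq rat,
    \sum_(i < size s) ratr s`_i * gz i t <=
      (w t)^-1 * `|\sum_(i < size s) (ratr s`_i : R) *: z i t|),
    (fun n => q (s n) t) @ \oo --> (0 : R) &
    ((fun n => xu (s n) t) @ \oo --> (0 : R) -> xf t = 0)].
  by apply: filterS3 comb sq van => t.
apply: filterS => t [combt qt vant] _ /=; congr EFin.
rewrite [RHS]mulrC.
apply: (@pointwise_attainment _ _ _ (f t) (fun n => u (s n) t) _
  (* Both defects, the first one multiplied by w t, lie below this bound. *)
  (fun n => g (s n) t) (fun n => w t * q (s n) t + q (s n) t)) => //.
- by rewrite invr_gt0.
- move=> c; have := combt c.
  rewrite (eq_bigr (fun i : 'I_(size c) => ratr c`_i *
    (if i : nat is n.+1 then g (s n) t else g0 t))); last by case=> [[]].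
  rewrite [X in _ <= _ * `|X|](eq_bigr (fun i : 'I_(size c) =>
    (ratr c`_i : R) *: (if i : nat is n.+1 then u (s n) t else f t)))//.
  by case=> [[]].
- move=> n; have : `|u (s n) t| - Num.max 0 (`|u (s n) t + f t| - `|f t|) =
      w t * a (s n) t by rewrite /a mulrC divfK// gt_eqF.
  move=> ->; rewrite /q mulrDr -addrA lerDl addr_ge0//.
    by rewrite mulr_ge0// ltW.
  exact: q0.
- move=> n; rewrite mulrC; apply: (@le_trans _ _ (q (s n) t)).
    by rewrite /q lerDr divr_ge0// ltW.
  by rewrite lerDr mulr_ge0// ltW.
- rewrite (_ : 0 = w t * 0 + 0); last by rewrite mulr0 addr0.
  by apply: cvgD => //; apply: cvgMr.
Qed.

End KoetheBochner.

Theorem theorem3p2 (R : realType) (d : measure_display) (S : measurableType d)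
    (mu : {sigma_finite_measure set S -> \bar R})
    (mu_complete : measure_is_complete mu)
    (E : koethe mu) (X : completeNormedModType R) :
  koethe_order_continuous E ->
  luacs X ->
  WLUR (kspace E) \/ (luacs_plus (kspace E) /\ kdual_order_continuous E) ->
  luacs (bochner_space X mu_complete E).
Proof.
move=> ocE lX hE x u F x1 u1 dF ux Fu.
have lE : luacs_plus (kspace E).
  by case: hE => [/WLUR_luacs_plus|[]].
have [G cG GE] := contractive_raw (fun z => dual_sphere_contraction z dF).
rewrite -(sreprK x) -GE.
apply: (@bochner_luacs _ _ _ mu mu_complete E X G (selt_val (srepr x))
  (fun n => selt_val (srepr (u n)))) => //.
- exact: (seltP (srepr x)).
- by move=> n; exact: (seltP (srepr (u n))).
- have -> : (fun n => bochner_norm E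
      (selt_val (srepr (u n)) + selt_val (srepr x))) = fun n => `|u n + x|.
    apply/funext => n.
    by rewrite -[in RHS](sreprK x) -[in RHS](sreprK (u n)) -sclassD squot_normE.
  exact: ux.
- have -> : (fun n => G (selt_val (srepr (u n)))) = fun n => F (u n).
    by apply/funext => n; rewrite GE sreprK.
  exact: Fu.
Qed.
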